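(* Let $g\geq 1$. For every Magnus submonoid $M$ of the orientable surface group $$S_g=\langle a_1,\dots,a_g,b_1,\dots,b_g\mid [a_1,b_1]\cdots[a_g,b_g]=1\rangle,$$ membership in $M$ is decidable. Furthermore, for every Magnus submonoid $M$ of the non-orientable surface group $$\mathcal{N}_g=\langle a_1,\dots,a_g\mid a_1^2\cdots a_g^2=1\rangle,$$ membership in $M$ is decidable.
   Context: $[a,b]=aba^{-1}b^{-1}$. Let $G=\langle A\mid r=1\rangle$ be a one-relator group. A letter $a\in A$ appears in $r$ if $a$ or $a^{-1}$ is a letter of $r$. A Magnus submonoid of $G$ (with respect to this presentation) is a submonoid generated by a subset $X\subseteq A\cup A^{-1}$ such that there is a letter $a$ appearing in $r$ with $\{a,a^{-1}\}\not\subseteq X$. In particular, if every letter of $A$ appears in $r$, a Magnus submonoid is one generated by a strict subset of $A\cup A^{-1}$. For a group $G$ generated by a finite set $A$ and a finitely generated submonoid $M\leq G$, membership in $M$ is decidable if there is an algorithm that takes any word over $A\cup A^{-1}$ and decides whether the element of $G$ it represents belongs to $M$. *)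

(* Defs.v *)
From HB Require Import structures.
From mathcomp Require Import all_boot.
From mathcomp Require Import boolp classical_sets.

Set Implicit Arguments.
Unset Strict Implicit.
Unset Printing Implicit Defensive.

Local Open Scope quotient_scope.
Local Open Scope group_scope.

(* The total functions obtained from zero, successor and projections by
   composition, primitive recursion and minimization of regular functions (for
   all v there is n with f (n, v) = 0). By Kleene's normal form theorem these
   are exactly the total computable functions. The constructed function is
   specified pointwise, so the class is closed under extensional equality. *)
Inductive recursive : forall k : nat, (k.-tuple nat -> nat) -> Prop :=
| recursive_zero :
    recursive (fun _ : 0.-tuple nat => 0)
| recursive_succ :
    recursive (fun v : 1.-tuple nat => (thead v).+1)
| recursive_proj (k : nat) (i : 'I_k) :
    recursive (fun v : k.-tuple nat => tnth v i)
| recursive_comp (k m : nat) (f : m.-tuple nat -> nat)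
    (g : 'I_m -> k.-tuple nat -> nat) (h : k.-tuple nat -> nat) :
    recursive f -> (forall i, recursive (g i)) ->
    (forall v, h v = f [tuple g i v | i < m]) ->
    recursive h
| recursive_primrec (k : nat) (f : k.-tuple nat -> nat)
    (g : k.+2.-tuple nat -> nat) (h : k.+1.-tuple nat -> nat) :
    recursive f -> recursive g ->
    (forall v : k.-tuple nat, h [tuple of 0 :: v] = f v) ->
    (forall (n : nat) (v : k.-tuple nat),
       h [tuple of n.+1 :: v] = g [tuple of n :: h [tuple of n :: v] :: v]) ->
    recursive h
| recursive_min (k : nat) (f : k.+1.-tuple nat -> nat) (h : k.-tuple nat -> nat) :
    recursive f ->
    (forall v : k.-tuple nat, f [tuple of h v :: v] = 0 /\
       forall n : nat, n < h v -> f [tuple of n :: v] <> 0) ->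
    recursive h.

(* (a, false) stands for a and (a, true) for its inverse. *)
Notation letter A := (A * bool)%type.

Definition pos (A : Type) (a : A) : letter A := (a, false).

Definition letter_inv (A : Type) (l : letter A) : letter A := (l.1, ~~ l.2).

Notation word A := (seq (letter A)).

Definition word_inv (A : Type) (w : word A) : word A :=
  rev [seq letter_inv l | l <- w].

Definition word_comm (A : Type) (u v : word A) : word A :=
  u ++ v ++ word_inv u ++ word_inv v.

(* Gödel number of a word: letters are numbered from 0 to 2 #|A| - 1, and
   CodeSeq.code is an effective bijection from finite sequences of naturals to
   naturals. *)
Definition word_code (A : finType) (w : word A) : nat :=
  CodeSeq.code [seq nat_of_ord (enum_rank l) | l <- w].

Definition decidable_language (A : finType) (L : set (word A)) : Prop :=
  exists2 f : 1.-tuple nat -> nat, recursive f &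
    forall w : word A, f [tuple word_code w] = nat_of_bool `[< L w >].

Definition letter_val (A : Type) (G : groupType) (gen : A -> G) (l : letter A) : G :=
  if l.2 then (gen l.1)^-1 else gen l.1.

Definition word_val (A : Type) (G : groupType) (gen : A -> G) (w : word A) : G :=
  \prod_(l <- w) letter_val gen l.

Definition is_submonoid (G : groupType) (M : set G) : Prop :=
  M 1 /\ (forall x y : G, M x -> M y -> M (x * y)).

Definition submonoid_generated (G : groupType) (X : set G) : set G :=
  smallest (@is_submonoid G) X.

Definition membership_decidable (A : finType) (G : groupType) (gen : A -> G)
    (M : set G) : Prop :=
  decidable_language [set w : word A | M (word_val gen w)].

Inductive word_equiv (A : Type) (r : word A) : word A -> word A -> Prop :=
| word_equiv_refl u : word_equiv r u u
| word_equiv_sym u v : word_equiv r u v -> word_equiv r v u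
| word_equiv_trans u v w : word_equiv r u v -> word_equiv r v w -> word_equiv r u w
| word_equiv_cancel u v l : word_equiv r (u ++ [:: l; letter_inv l] ++ v) (u ++ v)
| word_equiv_relator u v : word_equiv r (u ++ r ++ v) (u ++ v).

Section OneRelator.
Variables (A : finType) (r : word A).

Lemma word_equiv_ctx p q u v :
  word_equiv r u v -> word_equiv r (p ++ u ++ q) (p ++ v ++ q).
Proof.
elim=> {u v} [u|u v _|u v w _ IH1 _|u v l|u v].
- exact: word_equiv_refl.
- exact: word_equiv_sym.
- exact: word_equiv_trans IH1.
- have := word_equiv_cancel r (p ++ u) (v ++ q) l.
  by rewrite -!catA.
- have := word_equiv_relator r (p ++ u) (v ++ q).
  by rewrite -!catA.
Qed.

Lemma word_equiv_cat u u' v v' :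
  word_equiv r u u' -> word_equiv r v v' -> word_equiv r (u ++ v) (u' ++ v').
Proof.
move=> /(word_equiv_ctx [::] v) /= uu' /(word_equiv_ctx u' [::]) vv'.
by apply: word_equiv_trans uu' _; rewrite !cats0 in vv'.
Qed.

Lemma letter_invK : involutive (@letter_inv A).
Proof. by case=> a b; rewrite /letter_inv /= negbK. Qed.

Lemma word_invK : involutive (@word_inv A).
Proof.
move=> w; rewrite /word_inv map_rev revK -map_comp.
by rewrite (eq_map (g := id)) ?map_id // => l; exact: letter_invK.
Qed.

Lemma word_inv_cat (u v : word A) : word_inv (u ++ v) = word_inv v ++ word_inv u.
Proof. by rewrite /word_inv map_cat rev_cat. Qed.

Lemma word_equiv_mulV w : word_equiv r (w ++ word_inv w) [::].
Proof.
elim/last_ind: w => [|w l IH]; first exact: word_equiv_refl.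
rewrite -cats1 word_inv_cat -catA; apply: word_equiv_trans IH.
exact: (word_equiv_cancel r w (word_inv w) l).
Qed.

Lemma word_equiv_mulVl w : word_equiv r (word_inv w ++ w) [::].
Proof. by have := word_equiv_mulV (word_inv w); rewrite word_invK. Qed.

Lemma word_equiv_inv u v :
  word_equiv r u v -> word_equiv r (word_inv u) (word_inv v).
Proof.
move=> uv; apply: (@word_equiv_trans _ _ _ (word_inv u ++ (v ++ word_inv v))).
  have := word_equiv_ctx (word_inv u) [::] (word_equiv_mulV v).
  by rewrite !cats0; exact: word_equiv_sym.
have uv1 : word_equiv r (word_inv u ++ v) [::].
  apply: word_equiv_trans (word_equiv_mulVl u).
  by have := word_equiv_ctx (word_inv u) [::] (word_equiv_sym uv); rewrite !cats0.
by rewrite catA; exact: (word_equiv_ctx [::] (word_inv v) uv1).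
Qed.

Definition word_equivb (u v : word A) : bool := `[< word_equiv r u v >].

Lemma word_equivb_refl : reflexive word_equivb.
Proof. by move=> u; apply/asboolP; exact: word_equiv_refl. Qed.

Lemma word_equivb_sym : symmetric word_equivb.
Proof. by move=> u v; apply: asbool_equiv_eq; split; exact: word_equiv_sym. Qed.

Lemma word_equivb_trans : transitive word_equivb.
Proof.
move=> v u w /asboolP uv /asboolP vw.
by apply/asboolP; exact: word_equiv_trans vw.
Qed.

Canonical word_equiv_rel :=
  EquivRel word_equivb word_equivb_refl word_equivb_sym word_equivb_trans.

Definition one_relator_group : Type := {eq_quot word_equiv_rel}.
HB.instance Definition _ := Choice.on one_relator_group.
HB.instance Definition _ := EqQuotient.on one_relator_group.

Definition org_pi (w : word A) : one_relator_group := \pi_one_relator_group w.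

Lemma org_piK (x : one_relator_group) : org_pi (repr x) = x.
Proof. exact: reprK. Qed.

Lemma org_piP (u v : word A) :
  reflect (word_equiv r u v) (org_pi u == org_pi v).
Proof.
apply: (iffP idP) => [/eqP/eqmodP/asboolP //|uv].
by apply/eqP/eqmodP/asboolP.
Qed.

Definition org_one : one_relator_group := org_pi [::].
Definition org_mul (x y : one_relator_group) : one_relator_group :=
  org_pi (repr x ++ repr y).
Definition org_inv (x : one_relator_group) : one_relator_group :=
  org_pi (word_inv (repr x)).

Lemma repr_equiv w : word_equiv r (repr (org_pi w)) w.
Proof. by apply/org_piP; rewrite org_piK. Qed.

Lemma org_mul_pi u v : org_mul (org_pi u) (org_pi v) = org_pi (u ++ v).
Proof. by apply/eqP/org_piP; apply: word_equiv_cat; exact: repr_equiv. Qed.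

Lemma org_inv_pi u : org_inv (org_pi u) = org_pi (word_inv u).
Proof. by apply/eqP/org_piP; apply: word_equiv_inv; exact: repr_equiv. Qed.

Lemma org_mulA : associative org_mul.
Proof.
move=> x y z; rewrite -[x]org_piK -[y]org_piK -[z]org_piK.
by rewrite !org_mul_pi catA.
Qed.

Lemma org_mul1 : left_id org_one org_mul.
Proof. by move=> x; rewrite -[x]org_piK org_mul_pi. Qed.

Lemma org_1mul : right_id org_one org_mul.
Proof. by move=> x; rewrite -[x]org_piK org_mul_pi cats0. Qed.

Lemma org_mulV : left_inverse org_one org_inv org_mul.
Proof.
move=> x; rewrite -[x]org_piK org_inv_pi org_mul_pi.
by apply/eqP/org_piP; exact: word_equiv_mulVl.
Qed.

Lemma org_Vmul : right_inverse org_one org_inv org_mul.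
Proof.
move=> x; rewrite -[x]org_piK org_inv_pi org_mul_pi.
by apply/eqP/org_piP; exact: word_equiv_mulV.
Qed.

HB.instance Definition _ := isGroup.Build one_relator_group
  org_mulA org_mul1 org_1mul org_mulV org_Vmul.

Definition org_gen (a : A) : one_relator_group := org_pi [:: pos a].

Lemma word_val_org (w : word A) : word_val org_gen w = org_pi w.
Proof.
rewrite /word_val; elim: w => [|[a b] w IH]; first by rewrite big_nil.
rewrite big_cons IH /letter_val /=.
case: b => /=; last exact: org_mul_pi.
by rewrite [(org_gen a)^-1]org_inv_pi; exact: org_mul_pi.
Qed.

Lemma word_val_relator : word_val org_gen r = 1.
Proof.
rewrite word_val_org; apply/eqP/org_piP.
by have := word_equiv_relator r [::] [::]; rewrite /= cats0.
Qed.

Definition appears (a : A) : bool :=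
  (pos a \in r) || (letter_inv (pos a) \in r).

Definition magnus_submonoid (M : set one_relator_group) : Prop :=
  exists X : {set letter A},
    (exists a : A, appears a /\
       ~~ ([set pos a; letter_inv (pos a)]%SET \subset X)) /\
    M = submonoid_generated [set letter_val org_gen l | l in [set` X]].

End OneRelator.

Arguments magnus_submonoid {A} r M.

Lemma one_relator_group_universal (A : finType) (r : word A) (H : groupType)
    (f : A -> H) :
  word_val f r = 1 ->
  exists phi : one_relator_group r -> H,
    {morph phi : x y / x * y} /\ forall a, phi (org_gen r a) = f a.
Proof.
move=> fr.
have vcat u v : word_val f (u ++ v) = word_val f u * word_val f v.
  by rewrite /word_val big_cat.
have wd u v : word_equiv r u v -> word_val f u = word_val f v.
  elim=> {u v} [//|u v _ -> //|u v w _ -> _ -> //|u v l|u v].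
    rewrite !vcat; congr (_ * _).
    rewrite /word_val !big_cons big_nil /letter_val /=.
    by case: l => a [] /=; rewrite mulg1 ?mulVg ?mulgV mul1g.
  by rewrite !vcat fr mul1g.
exists (fun x => word_val f (repr x)); split=> [x y|a].
  by rewrite -vcat; apply: wd; exact: repr_equiv.
rewrite (wd _ _ (repr_equiv r [:: pos a])).
by rewrite /word_val big_seq1.
Qed.

(* inl i is a_i, inr i is b_i; indices run over 0, ..., g - 1. *)
Definition orientable_relator (g : nat) : word ('I_g + 'I_g) :=
  flatten [seq word_comm [:: pos (inl i)] [:: pos (inr i)] | i <- enum 'I_g].

Definition nonorientable_relator (g : nat) : word 'I_g :=
  flatten [seq [:: pos i; pos i] | i <- enum 'I_g].

Notation orientable_surface_group g :=
  (one_relator_group (orientable_relator g)).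

Notation nonorientable_surface_group g :=
  (one_relator_group (nonorientable_relator g)).

(* Main.v *)
Require Import Defs.
From mathcomp Require Import all_boot order ssralg ssrnum ssrint.
From mathcomp Require Import boolp classical_sets.
From mathcomp Require Import zify.

Set Implicit Arguments.
Unset Strict Implicit.
Unset Printing Implicit Defensive.

(** Let M be the Magnus submonoid generated by a set X of letters. The surface
    group is written as an HNN extension, with stable letter t, of a free group F
    along infinite cyclic subgroups, t c t^-1 = d, in such a way that the generators
    of M involve t positively only. An element of M is then a product
    x0 t x1 ... t xn whose factors in F can be recognized from their reduced words.
    Given w, Britton reduction either leaves some t^-1, and w is not in M, or brings
    w to the form w0 t w1 ... t wn. By the normal form theorem for HNN extensions
    (britton_red_nil, nf_linked), w is in M exactly when there are integers
    k_1, ..., k_n such that all the products c^(-k_i) w_i d^(k_(i+1)), where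
    k_0 = k_(n+1) = 0, are factors of the required kind. The point is that the k_i
    can be bounded, so that membership is decided by a bounded search
    (submonoid_decidable).

    In the orientable case the relator is t c t^-1 D up to rotation, where t is
    any generator and c is a letter; t^-1 may be assumed missing from X, by
    inverting everything if necessary. If c and c^-1 are not both in X, exponent
    sums of c make the sequence of the k_i monotone up to the lengths of the w_i
    (chain_bounded_monotone). If both are in X, the conditions on the different k_i
    are independent, and |k_i| can be taken at most the length of a factor, since
    longer powers of d do not cancel (chain_bounded_free, shifted_prefix).

    In the non-orientable case, M is the whole group when X contains each generator,
    or the inverse of each generator, because the relator is a positive word. If
    neither a nor a^-1 is in X for some generator a, then M lies in a free subgroup
    which is a factor of an amalgam, and this amalgam embeds in an HNN extension
    (root_decidable). Otherwise X contains a generator p and the inverse q of another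
    generator, but neither p^-1 nor q^-1, and these can be chosen so that the part U
    of the relator from p to q^-1 is a unit of M. Up to conjugation of q by U the
    relator then starts with p^2 q^-2, and s = q p^-1 turns it into
    p s^-1 p^-1 s^-1 ..., which defines an HNN extension with stable letter p in which
    p and q = s p are positive (positive_pair_decidable). There the powers k_i are
    bounded because a factor contains s at most once (chain_bounded_small).

    That the search is a recursive function is shown with combinators for
    functions between encoded types: pairing, finite case distinction, and
    recursion over lists. *)

(** * Recursive functions of few arguments *)

Definition recursive1 (f : nat -> nat) : Prop :=
  recursive (fun v : 1.-tuple nat => f (thead v)).

Definition recursive2 (f : nat -> nat -> nat) : Prop :=
  recursive (fun v : 2.-tuple nat => f (tnth v ord0) (tnth v (lift ord0 ord0))).

Definition recursive3 (f : nat -> nat -> nat -> nat) : Prop :=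
  recursive (fun v : 3.-tuple nat =>
    f (tnth v ord0) (tnth v (lift ord0 ord0)) (tnth v (lift ord0 (lift ord0 ord0)))).

Lemma recursive_ext k (f g : k.-tuple nat -> nat) :
  recursive f -> f =1 g -> recursive g.
Proof.
move=> rf fg; apply: (recursive_comp rf (recursive_proj (k := k))) => v.
rewrite -fg; congr f; apply: eq_from_tnth => i; by rewrite tnth_mktuple.
Qed.

Lemma recursive_app1 k f (g : k.-tuple nat -> nat) :
  recursive1 f -> recursive g -> recursive (fun v => f (g v)).
Proof.
move=> rf rg; apply: (recursive_comp (g := fun _ => g) rf) => // v.
by rewrite /thead tnth_mktuple.
Qed.

Lemma recursive_app2 k f (g1 g2 : k.-tuple nat -> nat) :
  recursive2 f -> recursive g1 -> recursive g2 ->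
  recursive (fun v => f (g1 v) (g2 v)).
Proof.
move=> rf r1 r2.
apply: (recursive_comp (g := fun i : 'I_2 => if i == ord0 then g1 else g2) rf).
  by move=> i; case: ifP.
by move=> v; rewrite !tnth_mktuple.
Qed.

Lemma recursive_app3 k f (g1 g2 g3 : k.-tuple nat -> nat) :
  recursive3 f -> recursive g1 -> recursive g2 -> recursive g3 ->
  recursive (fun v => f (g1 v) (g2 v) (g3 v)).
Proof.
move=> rf r1 r2 r3.
apply: (recursive_comp
  (g := fun i : 'I_3 => if i == ord0 then g1
        else if i == lift ord0 ord0 then g2 else g3) rf).
  by move=> i; case: ifP => // _; case: ifP.
by move=> v; rewrite !tnth_mktuple.
Qed.

Lemma recursive1_id : recursive1 id.
Proof. exact: (recursive_proj (ord0 : 'I_1)). Qed.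

Lemma recursive1_succ : recursive1 S.
Proof. exact: recursive_succ. Qed.

Lemma recursive_const k n : recursive (fun _ : k.-tuple nat => n).
Proof.
elim: n => [|n IH]; last exact: recursive_app1 recursive1_succ IH.
apply: (recursive_comp (m := 0) (g := fun _ _ => 0) recursive_zero); last by [].
by case.
Qed.

Lemma recursive2_primrec (f : nat -> nat) (g : nat -> nat -> nat -> nat)
    (h : nat -> nat -> nat) :
  recursive1 f -> recursive3 g ->
  (forall y, h 0 y = f y) -> (forall n y, h n.+1 y = g n (h n y) y) ->
  recursive2 h.
Proof.
move=> rf rg h0 hS; apply: (recursive_primrec rf rg) => [v|n v].
  by rewrite (tnth_nth 0) /= h0 /thead !(tnth_nth 0).
by rewrite !(tnth_nth 0) /= hS.
Qed.

Lemma recursive1_primrec (a : nat) (g : nat -> nat -> nat) (h : nat -> nat) :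
  recursive2 g -> h 0 = a -> (forall n, h n.+1 = g n (h n)) -> recursive1 h.
Proof.
move=> rg h0 hS.
have : recursive2 (fun n _ => h n).
  apply: (@recursive2_primrec (fun=> a) (fun n m _ => g n m)) => //.
    exact: recursive_const.
  by apply: recursive_app2 rg _ _; exact: recursive_proj.
move=> r2; exact: (recursive_app2 r2 recursive1_id recursive1_id).
Qed.

Lemma recursive2_swap f : recursive2 f -> recursive2 (fun x y => f y x).
Proof. by move=> rf; apply: (recursive_app2 rf); exact: recursive_proj. Qed.

Lemma recursive2_min (f : nat -> nat -> bool) (h : nat -> nat) :
  recursive2 (fun n x => f n x) ->
  (forall x, f (h x) x /\ forall n, n < h x -> ~~ f n x) -> recursive1 h.
Proof.
move=> rf fh.
have r1 : recursive1 (fun x => 1 - x).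
  apply: (@recursive1_primrec 1 (fun _ _ => 0)) => //.
  exact: recursive_const.
apply: (recursive_min (recursive_app1 r1 rf)) => v.
rewrite !(tnth_nth 0) /= -[thead v]/(tnth v ord0) (tnth_nth 0).
have [-> fmin] := fh (nth 0 v 0); split=> // n /fmin.
by rewrite !(tnth_nth 0) /=; case: (f _ _).
Qed.

Lemma recursive2_add : recursive2 addn.
Proof.
apply: (@recursive2_primrec id (fun _ m _ => m.+1)) => //.
  exact: recursive1_id.
by apply: (recursive_app1 recursive1_succ); exact: recursive_proj.
Qed.

Lemma recursive2_mul : recursive2 muln.
Proof.
apply: (@recursive2_primrec (fun=> 0) (fun _ m y => y + m)) => //.
  exact: recursive_const.
by apply: (recursive_app2 recursive2_add); exact: recursive_proj.
Qed.

Lemma recursive1_exp2 : recursive1 (expn 2).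
Proof.
apply: (@recursive1_primrec 1 (fun _ m => m + m)) => //.
  by apply: (recursive_app2 recursive2_add); exact: recursive_proj.
by move=> n; rewrite expnS mul2n addnn.
Qed.

Lemma recursive1_isz : recursive1 (fun x => x == 0).
Proof.
by apply: (@recursive1_primrec 1 (fun _ _ => 0)) => //; exact: recursive_const.
Qed.

Lemma recursive1_odd : recursive1 (fun x => odd x).
Proof.
apply: (@recursive1_primrec 0 (fun _ m => m == 0)) => //.
  by apply: (recursive_app1 recursive1_isz); exact: recursive_proj.
by move=> n /=; case: odd.
Qed.

Lemma recursive1_half : recursive1 half.
Proof.
apply: (@recursive1_primrec 0 (fun n m => odd n + m)) => //.
  apply: (recursive_app2 recursive2_add); last exact: recursive_proj.
  by apply: (recursive_app1 recursive1_odd); exact: recursive_proj.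
by move=> n /=; rewrite uphalf_half.
Qed.

Lemma recursive3_if : recursive3 (fun b x y => if b != 0 then x else y).
Proof.
apply: (@recursive_ext 3 (fun v => (tnth v ord0 == 0) * tnth v (lift ord0 (lift ord0 ord0))
   + ((tnth v ord0 == 0) == false :> nat) * tnth v (lift ord0 ord0))); last first.
  by move=> v /=; case: eqP => _ /=; lia.
apply: (recursive_app2 recursive2_add); apply: (recursive_app2 recursive2_mul);
  try exact: recursive_proj.
  by apply: (recursive_app1 recursive1_isz); exact: recursive_proj.
apply: (@recursive_ext 3 (fun v => (((tnth v ord0 == 0) : nat) == 0) : nat)).
  apply: (recursive_app1 recursive1_isz).
  by apply: (recursive_app1 recursive1_isz); exact: recursive_proj.
by move=> v; case: (tnth v ord0 == 0).
Qed.

Lemma recursive2_sub : recursive2 subn.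
Proof.
have r1 : recursive1 predn.
  apply: (@recursive1_primrec 0 (fun n _ => n)) => //.
  exact: recursive_proj.
apply: (recursive2_swap (f := fun y x => x - y)).
apply: (@recursive2_primrec id (fun _ m _ => m.-1)) => [||y|n y].
- exact: recursive1_id.
- by apply: (recursive_app1 r1); exact: recursive_proj.
- by rewrite subn0.
- by rewrite subnS.
Qed.

Lemma recursive2_eq : recursive2 (fun x y => x == y).
Proof.
apply: (@recursive_ext 2 (fun v =>
  (tnth v ord0 - tnth v (lift ord0 ord0)) +
  (tnth v (lift ord0 ord0) - tnth v ord0) == 0)); last first.
  by move=> v; congr nat_of_bool; lia.
apply: (recursive_app1 recursive1_isz).
apply: (recursive_app2 recursive2_add); apply: (recursive_app2 recursive2_sub);
  exact: recursive_proj.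
Qed.

(** * Lists of natural numbers as natural numbers *)

(** npair n m is the code of the list with head n whose tail has code m; it also
    serves as a pairing function. *)
Definition npair (n m : nat) : nat := 2 ^ n * m.*2.+1.
Definition nstrip (k n : nat) : nat := iter k half n.
Definition nhead (n : nat) : nat := logn 2 n.
Definition ntail (n : nat) : nat := (nstrip (nhead n) n)./2.

Lemma nstrip_npair k n m : k <= n -> nstrip k (npair n m) = npair (n - k) m.
Proof.
elim: k => [|k IH] kn; first by rewrite subn0.
rewrite /nstrip iterS -/(nstrip _ _) IH ?(ltnW kn) // /npair.
rewrite (_ : n - k = (n - k.+1).+1); last by lia.
by rewrite expnS -mulnA mul2n doubleK.
Qed.

Lemma nhead_npair n m : nhead (npair n m) = n.
Proof.
rewrite /nhead /npair lognM ?expn_gt0 // pfactorK // logn_coprime ?addn0 //.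
by rewrite coprime2n /= odd_double.
Qed.

Lemma ntail_npair n m : ntail (npair n m) = m.
Proof.
rewrite /ntail nhead_npair nstrip_npair // subnn /npair mul1n /= uphalf_double //.
Qed.

Lemma npair_surj n : 0 < n -> n = npair (nhead n) (ntail n).
Proof.
move=> n0; have := CodeSeq.decodeK n; case: (CodeSeq.decode n) => [|a s] /= E.
  by rewrite -E in n0.
by rewrite -E -/(npair _ _) nhead_npair ntail_npair.
Qed.

Lemma recursive2_npair : recursive2 npair.
Proof.
apply: (@recursive_ext 2 (fun v => 2 ^ tnth v ord0 *
  (tnth v (lift ord0 ord0) + tnth v (lift ord0 ord0)).+1)); last first.
  by move=> v; rewrite /npair addnn.
apply: (recursive_app2 recursive2_mul).
  by apply: (recursive_app1 recursive1_exp2); exact: recursive_proj.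
apply: (recursive_app1 recursive1_succ).
by apply: (recursive_app2 recursive2_add); exact: recursive_proj.
Qed.

Lemma recursive2_nstrip : recursive2 nstrip.
Proof.
apply: (@recursive2_primrec id (fun _ m _ => m./2)) => //.
  exact: recursive1_id.
by apply: (recursive_app1 recursive1_half); exact: recursive_proj.
Qed.

Lemma recursive1_nhead : recursive1 nhead.
Proof.
apply: (@recursive2_min (fun k n => (n == 0) || odd (nstrip k n))).
  apply: (@recursive_ext 2 (fun v =>
    if ((tnth v (lift ord0 ord0) == 0) : nat) != 0 then 1 else
    odd (nstrip (tnth v ord0) (tnth v (lift ord0 ord0))))); last first.
    by move=> v /=; case: (tnth v (lift ord0 ord0) == 0).
  apply: (recursive_app3 recursive3_if).
  - by apply: (recursive_app1 recursive1_isz); exact: recursive_proj.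
  - exact: recursive_const.
  - apply: (recursive_app1 recursive1_odd).
    by apply: (recursive_app2 recursive2_nstrip); exact: recursive_proj.
move=> [|x]; first by rewrite /nhead.
have := npair_surj (ltn0Sn x); set n := nhead _; set m := ntail _ => ->.
split=> [|k kn].
  by rewrite nstrip_npair // subnn /npair mul1n /= odd_double orbT.
rewrite nstrip_npair ?(ltnW kn) // /npair (_ : n - k = (n - k.+1).+1); last by lia.
rewrite [2 ^ (n - k.+1).+1]expnS -[2 * _ * _]mulnA mul2n odd_double orbF.
by rewrite muln_eq0 expn_eq0.
Qed.

Lemma recursive1_ntail : recursive1 ntail.
Proof.
apply: (recursive_app1 recursive1_half).
apply: (recursive_app2 recursive2_nstrip); last exact: recursive1_id.
exact: recursive1_nhead.
Qed.

Lemma recursive2_iter f : recursive1 f -> recursive2 (fun n x => iter n f x).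
Proof.
move=> rf; apply: (@recursive2_primrec id (fun _ m _ => f m)) => //.
  exact: recursive1_id.
by apply: (recursive_app1 rf); exact: recursive_proj.
Qed.

(** * Computable functions between encoded types *)

Definition enc_bool (b : bool) : nat := b.
Definition enc_fin (A : finType) (a : A) : nat := enum_rank a.
Definition enc_pair S T (eS : S -> nat) (eT : T -> nat) (p : S * T) : nat :=
  npair (eS p.1) (eT p.2).
Definition enc_seq T (eT : T -> nat) (s : seq T) : nat :=
  CodeSeq.code [seq eT x | x <- s].

Lemma enc_fin_inj (A : finType) : injective (@enc_fin A).
Proof. by move=> a b /ord_inj /enum_rank_inj. Qed.

Lemma enc_seq_inj T (eT : T -> nat) : injective eT -> injective (enc_seq eT).
Proof. by move=> eT_inj s1 s2 /(can_inj CodeSeq.codeK) /(inj_map eT_inj). Qed.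

Lemma enc_pair_inj S T (eS : S -> nat) (eT : T -> nat) :
  injective eS -> injective eT -> injective (enc_pair eS eT).
Proof.
move=> iS iT [x1 y1] [x2 y2]; rewrite /enc_pair /= => E.
have := congr1 nhead E; have := congr1 ntail E.
by rewrite !nhead_npair !ntail_npair => /iT -> /iS ->.
Qed.

Lemma enc_cons T (eT : T -> nat) x s :
  enc_seq eT (x :: s) = npair (eT x) (enc_seq eT s).
Proof. by []. Qed.

Section Computable.
Variables (S T U V : Type).
Variables (eS : S -> nat) (eT : T -> nat) (eU : U -> nat) (eV : V -> nat).

(** The realizer h is constrained on the codes eS s only, so eS may be any map. *)
Definition computable (f : S -> T) : Prop :=
  exists2 h, recursive1 h & forall s, h (eS s) = eT (f s).

End Computable.

Section Combinators.
Variables (S : Type) (eS : S -> nat).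

Lemma computable_ext T (eT : T -> nat) (f g : S -> T) :
  computable eS eT f -> f =1 g -> computable eS eT g.
Proof. by move=> [h rh hf] fg; exists h => // s; rewrite hf fg. Qed.

Lemma computable_id : computable eS eS id.
Proof. by exists id => //; exact: recursive1_id. Qed.

Lemma computable_comp T U (eT : T -> nat) (eU : U -> nat) f g :
  computable eT eU f -> computable eS eT g -> computable eS eU (fun s => f (g s)).
Proof.
move=> [h rh hf] [k rk kg]; exists (h \o k); first exact: (recursive_app1 rh rk).
by move=> s /=; rewrite kg hf.
Qed.

Lemma computable_const T (eT : T -> nat) (x : T) : computable eS eT (fun=> x).
Proof. by exists (fun=> eT x) => //; exact: recursive_const. Qed.

Lemma computable_pair T U (eT : T -> nat) (eU : U -> nat) f g :
  computable eS eT f -> computable eS eU g ->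
  computable eS (enc_pair eT eU) (fun s => (f s, g s)).
Proof.
move=> [h rh hf] [k rk kg]; exists (fun n => npair (h n) (k n)).
  exact: (recursive_app2 recursive2_npair rh rk).
by move=> s; rewrite hf kg.
Qed.

Lemma computable_fst T U (eT : T -> nat) (eU : U -> nat) f :
  computable eS (enc_pair eT eU) f -> computable eS eT (fun s => (f s).1).
Proof.
move=> [h rh hf]; exists (nhead \o h).
  exact: (recursive_app1 recursive1_nhead rh).
by move=> s /=; rewrite hf nhead_npair.
Qed.

Lemma computable_snd T U (eT : T -> nat) (eU : U -> nat) f :
  computable eS (enc_pair eT eU) f -> computable eS eU (fun s => (f s).2).
Proof.
move=> [h rh hf]; exists (ntail \o h).
  exact: (recursive_app1 recursive1_ntail rh).
by move=> s /=; rewrite hf ntail_npair.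
Qed.

Lemma computable_cons T (eT : T -> nat) f g :
  computable eS eT f -> computable eS (enc_seq eT) g ->
  computable eS (enc_seq eT) (fun s => f s :: g s).
Proof.
move=> [h rh hf] [k rk kg]; exists (fun n => npair (h n) (k n)).
  exact: (recursive_app2 recursive2_npair rh rk).
by move=> s; rewrite hf kg enc_cons.
Qed.

Lemma computable_if T (eT : T -> nat) b f g :
  computable eS enc_bool b -> computable eS eT f -> computable eS eT g ->
  computable eS eT (fun s => if b s then f s else g s).
Proof.
move=> [l rl lb] [h rh hf] [k rk kg].
exists (fun n => if l n != 0 then h n else k n).
  exact: (recursive_app3 recursive3_if rl rh rk).
by move=> s; rewrite lb hf kg; case: (b s).
Qed.

Lemma computable_match T E (eT : T -> nat) (eE : E -> nat) f (g : S -> E -> seq E -> T) l :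
  computable eS eT f ->
  computable (enc_pair eS (enc_pair eE (enc_seq eE))) eT (fun p => g p.1 p.2.1 p.2.2) ->
  computable eS (enc_seq eE) l ->
  computable eS eT (fun s => if l s is x :: t then g s x t else f s).
Proof.
move=> [h rh hf] [k rk kg] [m rm ml].
exists (fun n => if m n != 0 then k (npair n (m n)) else h n).
  apply: (recursive_app3 recursive3_if) => //; apply: (recursive_app1 rk).
  by apply: (recursive_app2 recursive2_npair) => //; exact: recursive1_id.
move=> s; rewrite ml hf; case: (l s) => [//|x t].
rewrite enc_cons {1}/npair muln_eq0 expn_eq0.
exact: (kg (s, (x, t))).
Qed.

Lemma computable_eq (T : eqType) (eT : T -> nat) f g :
  injective eT -> computable eS eT f -> computable eS eT g ->
  computable eS enc_bool (fun s => f s == g s).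
Proof.
move=> eT_inj [h rh hf] [k rk kg]; exists (fun n => h n == k n).
  exact: (recursive_app2 recursive2_eq rh rk).
by move=> s; rewrite hf kg (inj_eq eT_inj).
Qed.

(** A finite set carries no algorithmic content: a function defined separately
    on each of its elements is given by a finite table. *)
Lemma computable_finite (A : finType) T U (eT : T -> nat) (eU : U -> nat)
    (F : A -> U -> T) a g :
  (forall x, computable eU eT (F x)) ->
  computable eS (@enc_fin A) a -> computable eS eU g ->
  computable eS eT (fun s => F (a s) (g s)).
Proof.
move=> cF [k rk ka] cg.
suff [h rh hF] : exists2 h, recursive1 h &
    forall s, a s \in enum A -> h (eS s) = eT (F (a s) (g s)).
  by exists h => // s; rewrite hF ?mem_enum.
elim: (enum A) => [|x xs [h rh hF]]; first by exists id => //; exact: recursive1_id.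
have [l rl lF] := computable_comp (cF x) cg.
exists (fun n => if ((k n == enc_fin x) : nat) != 0 then l n else h n).
  apply: (recursive_app3 recursive3_if) => //.
  by apply: (recursive_app2 recursive2_eq) => //; exact: recursive_const.
move=> s; rewrite inE ka (inj_eq (@enc_fin_inj A)) lF.
by case: (eqVneq (a s) x) => [<- //|_] /= /hF.
Qed.

End Combinators.

(** Recursion over a list runs as a loop whose state is an accumulator and the
    entries that remain; the code of the list bounds the number of rounds. *)
Section Fold.
Variables (S T U : Type) (eS : S -> nat) (eT : T -> nat) (eU : U -> nat).

Definition fold_step (F : nat -> nat) (q : nat) : nat :=
  let s := nhead q in let acc := nhead (ntail q) in let l := ntail (ntail q) in
  if l != 0 then npair s (npair (F (npair s (npair (nhead l) acc))) (ntail l))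
  else q.

Lemma recursive1_fold_step F : recursive1 F -> recursive1 (fold_step F).
Proof.
move=> rF.
have rh := recursive1_nhead; have rt := recursive1_ntail.
have rtt := recursive_app1 rt rt; have rht := recursive_app1 rh rt.
apply: (recursive_app3 recursive3_if) => //; last exact: recursive1_id.
apply: (recursive_app2 recursive2_npair) => //.
apply: (recursive_app2 recursive2_npair); last exact: (recursive_app1 rt rtt).
apply: (recursive_app1 rF); apply: (recursive_app2 recursive2_npair) => //.
apply: (recursive_app2 recursive2_npair) => //; exact: (recursive_app1 rh rtt).
Qed.

Lemma leq_size_enc (l : seq T) : size l <= enc_seq eT l.
Proof.
elim: l => // x l; rewrite enc_cons /npair /= => IH.
have : 0 < 2 ^ eT x by rewrite expn_gt0.
by move: IH; set a := enc_seq _ _; set b := 2 ^ _; nia.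
Qed.

Lemma fold_step_nil F s a : fold_step F (npair s (npair a 0)) = npair s (npair a 0).
Proof. by rewrite /fold_step; cbv zeta; rewrite !ntail_npair. Qed.

Lemma fold_step_cons F s a x l :
  fold_step F (npair s (npair a (npair x l))) =
  npair s (npair (F (npair s (npair x a))) l).
Proof.
rewrite /fold_step; cbv zeta; rewrite !(ntail_npair, nhead_npair).
by rewrite {1}/npair muln_eq0 expn_eq0.
Qed.

Lemma iter_fold_step F (f : S -> T -> U -> U) s n l z :
  (forall x a, F (npair (eS s) (npair (eT x) (eU a))) = eU (f s x a)) ->
  size l <= n ->
  iter n (fold_step F) (npair (eS s) (npair (eU z) (enc_seq eT l))) =
  npair (eS s) (npair (eU (foldl (fun a x => f s x a) z l)) 0).
Proof.
move=> Ff; elim: n l z => [|n IH] [|x l] z // ln; rewrite iterSr.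
  by rewrite fold_step_nil (IH [::]).
by rewrite enc_cons fold_step_cons Ff IH.
Qed.

Lemma computable_foldl (f : S -> T -> U -> U) (z : S -> U) (l : S -> seq T) :
  computable (enc_pair eS (enc_pair eT eU)) eU (fun p => f p.1 p.2.1 p.2.2) ->
  computable eS eU z -> computable eS (enc_seq eT) l ->
  computable eS eU (fun s => foldl (fun a x => f s x a) (z s) (l s)).
Proof.
move=> [F rF Ff] [k rk kz] [m rm ml].
exists (fun n => nhead (ntail (iter (m n) (fold_step F)
  (npair n (npair (k n) (m n)))))).
  apply: (recursive_app1 recursive1_nhead); apply: (recursive_app1 recursive1_ntail).
  apply: (recursive_app2 (recursive2_iter (recursive1_fold_step rF))) => //.
  apply: (recursive_app2 recursive2_npair); first exact: recursive1_id.
  exact: (recursive_app2 recursive2_npair rk rm).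
move=> s; rewrite ml kz (iter_fold_step (f := f)) ?leq_size_enc //.
  by rewrite ntail_npair nhead_npair.
by move=> x a; apply: (Ff (s, (x, a))).
Qed.

End Fold.

Lemma computable_rev S (eS : S -> nat) T (eT : T -> nat) (l : S -> seq T) :
  computable eS (enc_seq eT) l -> computable eS (enc_seq eT) (fun s => rev (l s)).
Proof.
move=> cl; apply: (computable_ext (f := fun s =>
  foldl (fun a x => x :: a) [::] (l s))).
  apply: (computable_foldl (f := fun _ x a => x :: a)) cl => //.
    apply: computable_cons.
      exact: (computable_fst (computable_snd (computable_id _))).
    exact: (computable_snd (computable_snd (computable_id _))).
  exact: computable_const.
move=> s; rewrite /rev.
suff H : forall t r : seq T, foldl (fun a x => x :: a) r t = catrev t r by rewrite H.
by elim=> //= x t IH r; rewrite IH.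
Qed.


Lemma computable_foldr S (eS : S -> nat) T U (eT : T -> nat) (eU : U -> nat)
    (f : S -> T -> U -> U) (z : S -> U) (l : S -> seq T) :
  computable (enc_pair eS (enc_pair eT eU)) eU (fun p => f p.1 p.2.1 p.2.2) ->
  computable eS eU z -> computable eS (enc_seq eT) l ->
  computable eS eU (fun s => foldr (f s) (z s) (l s)).
Proof.
move=> cf cz /computable_rev cl.
apply: computable_ext (computable_foldl cf cz cl) _ => s.
by rewrite foldl_rev.
Qed.

Lemma computable_cat S (eS : S -> nat) T (eT : T -> nat) f g :
  computable eS (enc_seq eT) f -> computable eS (enc_seq eT) g ->
  computable eS (enc_seq eT) (fun s => f s ++ g s).
Proof.
move=> cf cg; apply: (computable_ext (f := fun s => foldr cons (g s) (f s))).
  apply: (computable_foldr (eT := eT) (f := fun=> cons) (l := f)) cg cf => //.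
  apply: computable_cons.
    exact: (computable_fst (computable_snd (computable_id _))).
  exact: (computable_snd (computable_snd (computable_id _))).
by move=> s; elim: (f s) => //= x t ->.
Qed.

Lemma computable_map S (eS : S -> nat) T U (eT : T -> nat) (eU : U -> nat) (f : S -> T -> U) l :
  computable (enc_pair eS eT) eU (fun p => f p.1 p.2) ->
  computable eS (enc_seq eT) l ->
  computable eS (enc_seq eU) (fun s => [seq f s x | x <- l s]).
Proof.
move=> cf cl; apply: (computable_ext (f := fun s =>
  foldr (fun x a => f s x :: a) [::] (l s))); last by move=> s; elim: (l s) => //= x t ->.
apply: (computable_foldr (f := fun s x a => f s x :: a)) cl => //; last exact: computable_const.
have ci := computable_id (enc_pair eS (enc_pair eT (enc_seq eU))).
apply: computable_cons; last exact: (computable_snd (computable_snd ci)).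
apply: (computable_comp cf (g := fun p => (p.1, p.2.1))).
apply: computable_pair; first exact: computable_fst ci.
exact: (computable_fst (computable_snd ci)).
Qed.

Lemma computable_flatten S (eS : S -> nat) T (eT : T -> nat) l :
  computable eS (enc_seq (enc_seq eT)) l ->
  computable eS (enc_seq eT) (fun s => flatten (l s)).
Proof.
move=> cl; apply: (computable_foldr (f := fun=> cat)) cl => //; last exact: computable_const.
have ci := computable_id (enc_pair eS (enc_pair (enc_seq eT) (enc_seq eT))).
apply: computable_cat; first exact: (computable_fst (computable_snd ci)).
exact: (computable_snd (computable_snd ci)).
Qed.

Lemma computable_has S (eS : S -> nat) T (eT : T -> nat) (p : S -> T -> bool) l :
  computable (enc_pair eS eT) enc_bool (fun q => p q.1 q.2) ->
  computable eS (enc_seq eT) l ->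
  computable eS enc_bool (fun s => has (p s) (l s)).
Proof.
move=> cp cl; apply: (computable_ext (f := fun s =>
  foldr (fun x b => if p s x then true else b) false (l s))).
  apply: (computable_foldr (f := fun s x b => if p s x then true else b)) cl => //.
    have ci := computable_id (enc_pair eS (enc_pair eT enc_bool)).
    apply: computable_if; last exact: (computable_snd (computable_snd ci)).
      apply: (computable_comp cp (g := fun p => (p.1, p.2.1))).
      apply: computable_pair; first exact: computable_fst ci.
      exact: (computable_fst (computable_snd ci)).
    exact: computable_const.
  exact: computable_const.
by move=> s; elim: (l s) => //= x t ->; case: (p s x).
Qed.

Definition words_upto T (X : seq T) (n : nat) : seq (seq T) :=
  iter n (fun L => [::] :: flatten [seq [seq x :: u | u <- L] | x <- X]) [:: [::]].

Lemma mem_words_upto (T : eqType) (X : seq T) n w :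
  (w \in words_upto X n) = (size w <= n) && all (mem X) w.
Proof.
elim: n w => [|n IH] [|x w] //=; rewrite inE /=.
apply/flattenP/and3P => [[s /mapP[y yX ->] /mapP[u]]|[sw xX wX]].
  by rewrite -/(words_upto X n) IH => /andP[su uX] [-> ->].
exists [seq x :: u | u <- words_upto X n]; first exact: map_f.
by apply: map_f; rewrite IH; apply/andP.
Qed.

(** The length is bounded in unary, by a list, so that the enumeration is a
    recursion over that list. *)
Lemma computable_words_upto S (eS : S -> nat) T (eT : T -> nat) (X : seq T)
    U (eU : U -> nat) (l : S -> seq U) :
  computable eS (enc_seq eU) l ->
  computable eS (enc_seq (enc_seq eT)) (fun s => words_upto X (size (l s))).
Proof.
move=> cl; apply: (computable_ext (f := fun s => foldr (fun (_ : U) L =>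
  [::] :: flatten [seq [seq x :: u | u <- L] | x <- X]) [:: [::]] (l s))); last first.
  by move=> s; elim: (l s) => //= x t ->.
apply: (computable_foldr (f := fun s (_ : U) L =>
  [::] :: flatten [seq [seq x :: u | u <- L] | x <- X])) cl => //; last exact: computable_const.
apply: computable_cons; first exact: computable_const.
apply: computable_flatten.
elim: X => [|x X IH] /=; first exact: computable_const.
apply: computable_cons IH.
apply: (computable_map (f := fun _ u => x :: u)).
  apply: computable_cons; first exact: computable_const.
  exact: computable_snd (computable_id _).
exact: (computable_snd (computable_snd (computable_id _))).
Qed.


Lemma decidable_computable (A : finType) (L : set (word A)) (b : word A -> bool) :
  computable (enc_seq (@enc_fin (letter A))) enc_bool b ->
  (forall w, L w <-> b w) -> decidable_language L.
Proof.
move=> [h rh hb] Lb; exists (fun v => h (thead v)) => // w.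
rewrite /thead (tnth_nth 0) /= -[word_code w]/(enc_seq (@enc_fin _) w) hb.
by congr nat_of_bool; apply/idP/asboolP => [/Lb|/Lb].
Qed.

Lemma computable_decidable (A : finType) (L : set (word A)) :
  decidable_language L ->
  computable (enc_seq (@enc_fin (letter A))) enc_bool (fun w => `[< L w >]).
Proof.
move=> [f rf fL]; exists (fun n => f [tuple n]) => [|w]; last exact: (fL w).
apply: recursive_ext rf _ => v; congr f; apply: eq_from_tnth => i.
by rewrite (ord1 i) [RHS](tnth_nth 0) /=.
Qed.

Local Open Scope group_scope.

(** * Integer powers *)

Section IntegerPowers.
Variable G : groupType.
Implicit Types (x : G) (k l : int).

Definition expgz x k : G := match k with Posz n => x ^+ n | Negz n => x ^- n.+1 end.

Lemma expgz_addr1 x k : expgz x (k + 1)%R = expgz x k * x.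
Proof.
case: k => [n|[|n]].
- have -> : (n%:Z + 1 = n.+1%:Z)%R by lia.
  by rewrite /= expgSr.
- by rewrite /= mulVg.
have -> : (Negz n.+1 + 1 = Negz n)%R by lia.
by rewrite /= [x ^+ n.+2]expgS invgM mulgVK.
Qed.

Lemma expgzD x k l : expgz x (k + l)%R = expgz x k * expgz x l.
Proof.
elim/int_ind: l => [|n IH|n IH]; first by rewrite GRing.addr0 mulg1.
  have -> : (k + n.+1%:Z = k + n%:Z + 1)%R by lia.
  by rewrite expgz_addr1 IH -mulgA /= expgSr.
apply: (mulIg x); rewrite -expgz_addr1 -mulgA -expgz_addr1.
have -> : (k - n.+1%:Z + 1 = k - n%:Z)%R by lia.
by have -> : (- n.+1%:Z + 1 = - n%:Z)%R by lia.
Qed.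

Lemma expgz0 x : expgz x 0%R = 1.
Proof. by []. Qed.

Lemma expgzN x k : expgz x (- k)%R = (expgz x k)^-1.
Proof. by apply: (mulgI (expgz x k)); rewrite -expgzD mulgV GRing.subrr. Qed.

Lemma expgz_inj x : (forall n, x ^+ n = 1 -> n = 0) -> injective (expgz x).
Proof.
move=> x_inf k l kl; apply/eqP; rewrite -GRing.subr_eq0; apply/eqP.
have : expgz x (k - l)%R = 1 by rewrite expgzD expgzN kl mulgV.
case: (k - l)%R => n /= => [/x_inf -> //|/(congr1 (fun y => y^-1))].
by rewrite invgK invg1 => /x_inf.
Qed.

Lemma expgz_conj t c d k : t * c = d * t -> t * expgz c k = expgz d k * t.
Proof.
move=> tc; have E : d = t * c * t^-1 by rewrite tc mulgK.
have nE n : t * c ^+ n = d ^+ n * t.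
  elim: n => [|n IH]; first by rewrite mulg1 mul1g.
  by rewrite !expgS mulgA tc -mulgA IH mulgA.
case: k => n //=; apply: (mulgI (d ^+ n.+1)).
by rewrite mulgA -nE -mulgA mulgV mulg1 mulVKg.
Qed.

End IntegerPowers.

(** * Normal forms in HNN extensions along infinite cyclic subgroups *)

Section HNN.
(** gam false and gam true embed the integers onto the two associated subgroups;
    the stable letter t conjugates gam false k to gam true k. *)
Variables (F : groupType) (gam : bool -> int -> F).
Hypothesis gamD : forall e k l, gam e (k + l)%R = gam e k * gam e l.
Hypothesis gam_inj : forall e, injective (gam e).

Lemma gam0 e : gam e 0%R = 1.
Proof. by apply: (mulgI (gam e 0%R)); rewrite -gamD mulg1 GRing.addr0. Qed.

Lemma gamN e k : gam e (- k)%R = (gam e k)^-1.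
Proof. by apply: (mulgI (gam e k)); rewrite -gamD mulgV GRing.subrr gam0. Qed.

Definition in_sub e f : Prop := exists k, f = gam e k.

(** A representative of the coset of f under left multiplication by the image of
    gam e. It is chosen as a function of the coset alone, with 1 representing
    the subgroup itself. *)
Definition rep e (f : F) : F :=
  if `[< in_sub e f >] then 1 else choose (fun g => `[< exists k, g = gam e k * f >]) f.

Lemma rep_spec e f : exists k, f = gam e k * rep e f.
Proof.
rewrite /rep; case: asboolP => [[k ->]|_]; first by exists k; rewrite mulg1.
have /asboolP [k ->] : `[< exists k, choose (fun g => `[< exists k, g = gam e k * f >]) f = gam e k * f >].
  apply: (@chooseP _ (fun g => `[< exists k, g = gam e k * f >])).
  by apply/asboolP; exists 0%R; rewrite gam0 mul1g.
by exists (- k)%R; rewrite gamN mulKg.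
Qed.

Definition coef e f : int := projT1 (cid (rep_spec e f)).

Lemma coefK e f : f = gam e (coef e f) * rep e f.
Proof. exact: projT2 (cid (rep_spec e f)). Qed.

Lemma in_subM e k f : in_sub e (gam e k * f) <-> in_sub e f.
Proof.
split=> [[l E]|[l ->]]; last by exists (k + l)%R; rewrite gamD.
by exists (- k + l)%R; rewrite gamD -E gamN mulKg.
Qed.

Lemma repM e k f : rep e (gam e k * f) = rep e f.
Proof.
rewrite /rep (asbool_equiv_eq (in_subM e k f)); case: ifP => // _.
have E : (fun g => `[< exists k0, g = gam e k0 * (gam e k * f) >]) =1
         (fun g => `[< exists k0, g = gam e k0 * f >]).
  move=> g; apply: asbool_equiv_eq; split=> -[l ->].
    by exists (l + k)%R; rewrite gamD mulgA.
  by exists (l - k)%R; rewrite gamD gamN mulgA mulgVK.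
rewrite (eq_choose E); apply: choose_id; apply/asboolP.
  by exists k.
by exists 0%R; rewrite gam0 mul1g.
Qed.

Lemma rep_id e f : rep e (rep e f) = rep e f.
Proof. by have [k E] := rep_spec e f; rewrite -(repM e k (rep e f)) -E. Qed.

Lemma rep1P e f : rep e f = 1 <-> in_sub e f.
Proof.
split=> [r1|fs]; last by rewrite /rep; case: asboolP.
by exists (coef e f); rewrite [LHS](coefK e) r1 mulg1.
Qed.

Lemma coefM e k f : rep e f = f -> coef e (gam e k * f) = k.
Proof.
move=> rf; have := coefK e (gam e k * f); rewrite repM rf => /mulIg /gam_inj.
by [].
Qed.


(** The pair (f, [:: (e1, f1); ...]) stands for the product of f and the
    factors t^(e1) f1, ..., where e is false for t and true for its inverse. *)
Definition state : Type := (F * seq (bool * F))%type.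

(** The tail of a normal form: the factors are coset representatives, and no
    t^(e) t^(-e) is left. *)
Fixpoint valid (l : seq (bool * F)) : Prop :=
  if l is (e, f) :: l' then
    [/\ rep e f = f, (f = 1 -> ohead (unzip1 l') <> Some (~~ e)) & valid l']
  else True.

Definition push_elt (h : F) (s : state) : state := (h * s.1, s.2).

(** Left multiplication by t^(e): the part of f in the associated subgroup moves
    to the other side of t^(e), which cancels if only t^(-e) comes next. *)
Definition push_t (e : bool) (s : state) : state :=
  let k := coef e s.1 in let f := rep e s.1 in
  if s.2 is (e1, f1) :: l then
    if (f == 1) && (e1 == ~~ e) then (gam (~~ e) k * f1, l)
    else (gam (~~ e) k, (e, f) :: s.2)
  else (gam (~~ e) k, [:: (e, f)]).

Lemma push_tE e k f l : rep e f = f -> (f = 1 -> ohead (unzip1 l) <> Some (~~ e)) ->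
  push_t e (gam e k * f, l) = (gam (~~ e) k, (e, f) :: l).
Proof.
move=> rf; rewrite /push_t /= repM rf coefM //.
case: l => [|[e1 f1] l] //=; case: eqP => //= -> /(_ erefl).
by case: eqP => // ->.
Qed.

Lemma push_t_pinch e k f1 l :
  push_t e (gam e k, (~~ e, f1) :: l) = (gam (~~ e) k * f1, l).
Proof.
rewrite /push_t /=.
have r1 : rep e 1 = 1 by apply/rep1P; exists 0%R; rewrite gam0.
by rewrite -[gam e k]mulg1 repM coefM // r1 !eqxx.
Qed.

Lemma push_t_valid e s : valid s.2 -> valid (push_t e s).2.
Proof.
rewrite /push_t; case: s => f [|[e1 f1] l] /=; first by rewrite rep_id.
move=> [rf1 nf1 vl]; case: ifP => //= nr; rewrite rep_id.
by split=> //; move=> r1 [e1e]; move: nr; rewrite r1 e1e !eqxx.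
Qed.

(** If t^(e) has been cancelled against the head of the tail, validity ensures
    that t^(-e) is not cancelled in turn. *)
Lemma push_tK e s : valid s.2 -> push_t (~~ e) (push_t e s) = s.
Proof.
case: s => f l /= vl; have [k ->] := rep_spec e f.
have := rep_id e f; move: (rep e f) => {}f rf.
have [] := pselect (f = 1 -> ohead (unzip1 l) <> Some (~~ e)) => [nf|].
  rewrite push_tE //; case: e k rf nf => k rf nf; exact: push_t_pinch.
move=> /not_implyP[-> /contrapT]; rewrite mulg1.
case: l vl => [|[e1 f1] l] //= [rf1 nf1 vl] [e1E]; rewrite {e1}e1E in rf1 nf1 *.
by rewrite push_t_pinch push_tE // negbK.
Qed.

(** With push_tK, this makes the states with a valid tail a set on which the HNN
    extension acts; equal elements thus have equal normal forms. *)
Lemma push_t_comm e k s :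
  push_t e (push_elt (gam e k) s) = push_elt (gam (~~ e) k) (push_t e s).
Proof.
case: s => f l; have [j ->] := rep_spec e f; have := rep_id e f.
move: (rep e f) => {}f rf; rewrite /push_elt /= mulgA -gamD.
have [] := pselect (f = 1 -> ohead (unzip1 l) <> Some (~~ e)) => [nf|].
  by rewrite !push_tE //= gamD.
move=> /not_implyP[-> /contrapT]; rewrite !mulg1.
case: l => [|[e1 f1] l] //= [->].
by rewrite !push_t_pinch /= gamD mulgA.
Qed.

End HNN.

(** * Words, presentations and free reduction *)

Section Presentation.
Variables (A : finType) (r : word A).
Implicit Types u v w : word A.

Lemma org_pi_cat u v : org_pi r (u ++ v) = org_pi r u * org_pi r v.
Proof. by rewrite -[RHS]/(org_mul _ _) org_mul_pi. Qed.

Lemma org_pi_inv u : org_pi r (word_inv u) = (org_pi r u)^-1.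
Proof. by rewrite -[RHS]/(org_inv _) org_inv_pi. Qed.

Lemma org_pi_nil : org_pi r [::] = 1.
Proof. by []. Qed.

Lemma org_pi_eq u v : org_pi r u = org_pi r v <-> word_equiv r u v.
Proof. by split=> [/eqP/org_piP|/org_piP/eqP]. Qed.

Lemma org_pi_relator : org_pi r r = 1.
Proof. by apply/org_pi_eq; have := word_equiv_relator r [::] [::]; rewrite cats0. Qed.

Lemma org_pi_cons l u : org_pi r (l :: u) = org_pi r [:: l] * org_pi r u.
Proof. by rewrite -org_pi_cat. Qed.

Lemma org_pi_letter_inv l : org_pi r [:: letter_inv l] = (org_pi r [:: l])^-1.
Proof. by rewrite -org_pi_inv. Qed.

Lemma org_pi_true a : org_pi r [:: (a, true)] = (org_pi r [:: pos a])^-1.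
Proof. exact: org_pi_letter_inv (pos a). Qed.

End Presentation.

Section Substitution.
Variables (A B : finType).

Definition subst_letter (f : A -> word B) (l : letter A) : word B :=
  if l.2 then word_inv (f l.1) else f l.1.

Definition subst (f : A -> word B) (w : word A) : word B :=
  flatten [seq subst_letter f l | l <- w].

Lemma subst_cat f u v : subst f (u ++ v) = subst f u ++ subst f v.
Proof. by rewrite /subst map_cat flatten_cat. Qed.

Lemma subst_cons f l u : subst f (l :: u) = subst_letter f l ++ subst f u.
Proof. by []. Qed.

Lemma subst_pos f a : subst f [:: pos a] = f a.
Proof. exact: cats0. Qed.

Lemma subst_neg f a : subst f [:: (a, true)] = word_inv (f a).
Proof. exact: cats0. Qed.

Lemma subst_inv f u : subst f (word_inv u) = word_inv (subst f u).
Proof.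
elim: u => // -[a b] u IH.
rewrite -cat1s word_inv_cat !subst_cat word_inv_cat IH /subst /= !cats0.
by rewrite /subst_letter /=; case: b; rewrite ?word_invK.
Qed.

Lemma subst_equiv r s f u v :
  word_equiv s (subst f r) [::] -> word_equiv r u v ->
  word_equiv s (subst f u) (subst f v).
Proof.
move=> /org_pi_eq fr uv; apply/org_pi_eq; elim: uv => {u v}.
- by [].
- by move=> u v _ ->.
- by move=> u v w _ -> _ ->.
- move=> u v l; rewrite !subst_cat !org_pi_cat org_pi_nil mulg1.
  have -> : subst_letter f (letter_inv l) = word_inv (subst_letter f l).
    by rewrite /subst_letter; case: l => a [] /=; rewrite ?word_invK.
  by rewrite org_pi_inv mulgV mul1g.
- by move=> u v; rewrite !subst_cat !org_pi_cat fr mul1g.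
Qed.

End Substitution.

Section CyclicRelator.
Variables (A : finType).

(** Cyclic conjugates of a relator have the same normal closure. *)
Lemma word_equiv_rot (p q u v : word A) :
  word_equiv (p ++ q) u v -> word_equiv (q ++ p) u v.
Proof.
have E : word_equiv (q ++ p) (p ++ q) [::].
  apply/org_pi_eq; rewrite org_pi_cat.
  by have := org_pi_relator (q ++ p); rewrite org_pi_cat => /mulg1_eq <-; rewrite mulVg.
elim=> {u v} [u|u v _|u v w _ IH1 _|u v l|u v].
- exact: word_equiv_refl.
- exact: word_equiv_sym.
- exact: word_equiv_trans IH1.
- exact: word_equiv_cancel.
- by have := word_equiv_ctx u v E.
Qed.

End CyclicRelator.

Section FreeReduction.
Variable A : finType.
Implicit Types (l : letter A) (u v w : word A).

Definition push_letter l w : word A :=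
  if w is l' :: w' then if l' == letter_inv l then w' else l :: w else [:: l].

(** Free reduction reads the word from right to left, the reduced part being a
    stack. *)
Definition red w : word A := foldr push_letter [::] w.

Definition compat l l' : bool := l' != letter_inv l.

Definition reduced w : bool := sorted compat w.

Lemma reduced_cons l w : reduced (l :: w) -> reduced w.
Proof. exact: path_sorted. Qed.

Lemma push_letter_reduced l w : reduced w -> reduced (push_letter l w).
Proof.
case: w => [//|l' w] rw /=; case: eqP => [_|/eqP nl]; first exact: reduced_cons rw.
by rewrite /reduced /= /compat nl.
Qed.

Lemma red_reduced w : reduced (red w).
Proof. by elim: w => // l w; exact: push_letter_reduced. Qed.

Lemma reduced_red w : reduced w -> red w = w.
Proof.
elim: w => // l w IH rw /=; rewrite IH ?(reduced_cons rw) //.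
case: w rw {IH} => //= l' w /andP[cl _].
by rewrite ifN.
Qed.

Lemma letter_inv_neq l : letter_inv l != l.
Proof. by case: l => a b; rewrite /letter_inv xpair_eqE /= andbC; case: b. Qed.

Lemma push_letterK l w : reduced w -> push_letter l (push_letter (letter_inv l) w) = w.
Proof.
case: w => [|l' w] rw /=; first by rewrite eqxx.
rewrite letter_invK; case: eqP rw => [->|_] rw /=; last by rewrite eqxx.
by case: w rw => [//|l1 w] /= /andP[cl _]; rewrite ifN.
Qed.

Lemma red_cat u v : red (u ++ v) = foldr push_letter (red v) u.
Proof. by rewrite /red foldr_cat. Qed.

Lemma red_equiv u v : word_equiv [::] u v -> red u = red v.
Proof.
elim=> {u v} [//|u v _ -> //|u v w _ -> _ -> //|u v l|u v]; last by [].
by rewrite !red_cat /= push_letterK ?red_reduced.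
Qed.

Lemma push_letter_val r l w : org_pi r (push_letter l w) = org_pi r (l :: w).
Proof.
case: w => //= l' w; case: eqP => // ->.
by rewrite [RHS]org_pi_cons [X in _ * X]org_pi_cons org_pi_letter_inv mulVKg.
Qed.

Lemma red_val r w : org_pi r (red w) = org_pi r w.
Proof.
by elim: w => //= l w IH; rewrite push_letter_val [LHS]org_pi_cons IH -org_pi_cons.
Qed.

Lemma org_pi_red u v : org_pi [::] u = org_pi [::] v <-> red u = red v.
Proof.
split=> [/org_pi_eq/red_equiv //|E].
by rewrite -(red_val _ u) E red_val.
Qed.

Lemma sub_push_letter l w : {subset push_letter l w <= l :: w}.
Proof.
case: w => [|l' w] x /=; first by [].
by case: ifP => // _ xw; rewrite 2!in_cons xw !orbT.
Qed.

Lemma sub_foldr_push_letter u v : {subset foldr push_letter v u <= u ++ v}.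
Proof.
elim: u => //= l u IH x /sub_push_letter; rewrite !inE.
by case/orP => [->//|/IH ->]; rewrite orbT.
Qed.

Lemma sub_red w : {subset red w <= w}.
Proof. by move=> x /sub_foldr_push_letter; rewrite cats0. Qed.

Lemma red_rcons u l : l \notin u -> letter_inv l \notin u -> red (rcons u l) = rcons (red u) l.
Proof.
move=> lu lu'; have -> : red (rcons u l) = red (rcons (red u) l).
  by apply/org_pi_red; rewrite -!cats1 !org_pi_cat red_val.
apply: reduced_red; have := red_reduced u; rewrite /reduced.
have ul : {in red u, forall l', compat l' l}.
  move=> l' /sub_red l'u; rewrite /compat eq_sym (inv_eq (@letter_invK A)).
  by apply: contraNneq lu' => <-.
case: (red u) ul => // l' w ul /= lw; rewrite rcons_path lw.
exact/ul/mem_last.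
Qed.

Lemma size_foldr_push_letter u v : size (foldr push_letter v u) <= size u + size v.
Proof.
elim: u => //= l u IH; case: foldr IH => //= l' w; case: ifP => _ /=; lia.
Qed.

Lemma size_red w : size (red w) <= size w.
Proof. by have := size_foldr_push_letter w [::]; rewrite addn0. Qed.

(** Each letter of u removes at most one letter of the stack, so the part v'
    below v is never reached. *)
Lemma foldr_push_letter_cat u v v' : size u <= size v ->
  foldr push_letter (v ++ v') u = foldr push_letter v u ++ v'.
Proof.
move=> uv.
suff [] : foldr push_letter (v ++ v') u = foldr push_letter v u ++ v' /\
  size v <= size u + size (foldr push_letter v u) by [].
elim: u uv => //= l u IH lu; have [|-> s1] := IH; first by lia.
case: foldr s1 => [|l' w] /= s1; first by lia.
by case: ifP => _ /=; split => //; lia.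
Qed.

End FreeReduction.

(** * Powers of cyclically reduced words *)

Section Powers.
Variable A : finType.
Implicit Types (w : word A) (k : int).

Definition wpow w k : word A :=
  match k with
  | Posz n => flatten (nseq n w)
  | Negz n => flatten (nseq n.+1 (word_inv w))
  end.

Lemma org_pi_nseq r w n : org_pi r (flatten (nseq n w)) = org_pi r w ^+ n.
Proof. by elim: n => // n IH; rewrite /= org_pi_cat IH expgS. Qed.

Lemma org_pi_wpow r w k : org_pi r (wpow w k) = expgz (org_pi r w) k.
Proof.
case: k => n; rewrite org_pi_nseq // org_pi_inv.
by rewrite expVgn.
Qed.

(** As a cycle, w is compatible with itself also when it consists of one letter,
    and powers of w are then reduced as they stand. *)
Definition cyc_reduced w : bool := (w != [::]) && cycle (@compat A) w.

Lemma cyc_reduced_pow w n : cyc_reduced w -> reduced (flatten (nseq n w)).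
Proof.
case: w => // x p /andP[_] /=; rewrite rcons_path => /andP[xp px].
suff H m : path (@compat A) x (p ++ flatten (nseq m (x :: p))).
  by case: n => // n; exact: H.
by elim: m => [|m IH]; rewrite ?cats0 //= cat_path xp /= px.
Qed.

Lemma cyc_reduced_inv w : cyc_reduced w -> cyc_reduced (word_inv w).
Proof.
rewrite /cyc_reduced -size_eq0 -[word_inv w == _]size_eq0 size_rev size_map.
move=> /andP[-> cw] /=.
rewrite rev_cycle cycle_map; apply: sub_cycle cw => x y /=.
by rewrite /compat /relpre letter_invK eq_sym inv_eq //; exact: letter_invK.
Qed.

Lemma size_flatten_nseq w n : size (flatten (nseq n w)) = (n * size w)%N.
Proof. by elim: n => //= n IH; rewrite size_cat IH mulSn. Qed.

(** The powers of w being reduced, the reduced form of u has at least |k| |w|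
    letters. *)
Lemma cyc_reduced_size_pow w u k : cyc_reduced w ->
  org_pi [::] u = expgz (org_pi [::] w) k -> absz k <= size u.
Proof.
move=> cw; rewrite -org_pi_wpow => /org_pi_red E.
apply: (leq_trans _ (size_red u)); rewrite E.
have H w' n : cyc_reduced w' -> n <= size (red (flatten (nseq n w'))).
  move=> cw'; rewrite reduced_red ?cyc_reduced_pow // size_flatten_nseq.
  by case/andP: cw'; case: w' => // x p _ _ /=; rewrite leq_pmulr.
case: k {E} => n; first exact: H.
by apply: (H _ n.+1); exact: cyc_reduced_inv.
Qed.

Lemma cyc_reduced_inf w : cyc_reduced w -> injective (expgz (org_pi [::] w)).
Proof.
move=> cw; apply: expgz_inj => n wn.
have := @cyc_reduced_size_pow w [::] n cw; rewrite /= wn leqn0 => /(_ erefl).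
by move/eqP.
Qed.

End Powers.

(** * Words in an HNN extension of a free group *)

Section HNNWords.
Variable A : finType.

Definition emb (w : word A) : word (option A) := [seq (Some l.1, l.2) | l <- w].

Lemma emb_cat u v : emb (u ++ v) = emb u ++ emb v.
Proof. exact: map_cat. Qed.

Lemma emb_inv u : emb (word_inv u) = word_inv (emb u).
Proof. by rewrite /emb /word_inv map_rev -!map_comp. Qed.

Lemma emb_subst u : emb u = subst (fun a => [:: pos (Some a)]) u.
Proof. by elim: u => // -[a []] u IH; rewrite /= IH. Qed.

(** The base group maps to any group over the larger alphabet. *)
Lemma emb_equiv r u v :
  org_pi [::] u = org_pi [::] v -> org_pi r (emb u) = org_pi r (emb v).
Proof.
move=> /org_pi_eq uv; apply/org_pi_eq; rewrite !emb_subst.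
by apply: subst_equiv uv; exact: word_equiv_refl.
Qed.

(** The relator t c t^-1 d^-1 in which None is the stable letter t. *)
Definition hnn_relator (c d : word A) : word (option A) :=
  pos None :: emb c ++ (None, true) :: emb (word_inv d).

Variables c d : word A.
Hypotheses (cyc_c : cyc_reduced c) (cyc_d : cyc_reduced d).

Local Notation F := (one_relator_group (A := A) [::]).
Local Notation rho := (hnn_relator c d).
Local Notation fv := (org_pi [::]).
Local Notation hv := (org_pi rho).

Definition assoc_word (e : bool) : word A := if e then d else c.

Definition assoc_pow (e : bool) (k : int) : F := expgz (fv (assoc_word e)) k.

Lemma assoc_powD e k l : assoc_pow e (k + l)%R = assoc_pow e k * assoc_pow e l.
Proof. exact: expgzD. Qed.

Lemma assoc_pow_inj e : injective (assoc_pow e).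
Proof. by apply: cyc_reduced_inf; case: e. Qed.

Local Notation state := (F * seq (bool * F))%type.
Local Notation pusht := (push_t assoc_powD).
Local Notation validl := (@valid _ assoc_pow).

Definition act_letter (l : letter (option A)) (s : state) : state :=
  if l.1 is Some a then push_elt (fv [:: (a, l.2)]) s else pusht l.2 s.

Definition act (w : word (option A)) (s : state) : state := foldr act_letter s w.

Lemma act_cat u v s : act (u ++ v) s = act u (act v s).
Proof. exact: foldr_cat. Qed.

Lemma push_eltM g h (s : state) : push_elt (g * h) s = push_elt g (push_elt h s).
Proof. by rewrite /push_elt /= mulgA. Qed.

Lemma push_elt1 (s : state) : push_elt 1 s = s.
Proof. by case: s => f l; rewrite /push_elt mul1g. Qed.

Lemma act_emb w s : act (emb w) s = push_elt (fv w) s.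
Proof.
elim: w => [|[a b] w IH]; first by rewrite push_elt1.
by rewrite org_pi_cons push_eltM -IH.
Qed.

Lemma act_valid w s : validl s.2 -> validl (act w s).2.
Proof.
move=> vs; elim: w => //= -[[a|] b] w IH; rewrite /act_letter //=.
by apply: push_t_valid.
Qed.

Lemma act_letterK l s : validl s.2 -> act_letter l (act_letter (letter_inv l) s) = s.
Proof.
case: l => -[a|] b vs; rewrite /act_letter /=.
  by rewrite -push_eltM -[(a, ~~ b)]/(letter_inv (a, b)) org_pi_letter_inv mulgV push_elt1.
rewrite -{1}(negbK b); apply: push_tK => //; exact: assoc_pow_inj.
Qed.

Lemma act_equiv u v s : word_equiv rho u v -> validl s.2 -> act u s = act v s.
Proof.
move=> uv; elim: uv s => {u v} [//|u v _ IH s /IH//|u v w _ IH1 _ IH2 s vs|u v l s vs|u v s vs].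
- by rewrite IH1 // IH2.
- by rewrite !act_cat /= act_letterK //; exact: act_valid.
- rewrite !act_cat; congr act; move: (act v s) (act_valid v vs) => {u v vs}s vs.
  rewrite /hnn_relator -cat1s !act_cat !act_emb -[act ((None, true) :: _) s]/(act_letter (None, true) (act _ s)).
  rewrite act_emb org_pi_inv /= /act_letter /=.
  have -> : fv c = assoc_pow false 1%R by [].
  rewrite push_t_comm; last exact: assoc_pow_inj.
  rewrite (push_tK assoc_powD assoc_pow_inj true) //.
  by rewrite -push_eltM [assoc_pow _ _]/(fv d) mulgV push_elt1.
Qed.

Definition nf (w : word (option A)) : state := act w (1, [::]).

Lemma nf_equiv u v : hv u = hv v -> nf u = nf v.
Proof. by move=> /org_pi_eq uv; exact: act_equiv. Qed.

Lemma nf_emb_cat u w : nf (emb u ++ w) = push_elt (fv u) (nf w).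
Proof. by rewrite /nf act_cat act_emb. Qed.

Lemma hnn_rel : hv [:: pos None] * hv (emb c) = hv (emb d) * hv [:: pos None].
Proof.
have : hv ([:: pos None] ++ emb c ++ [:: letter_inv (pos None)] ++ word_inv (emb d)) = 1.
  by rewrite -emb_inv; exact: org_pi_relator rho.
rewrite !org_pi_cat org_pi_inv org_pi_letter_inv !mulgA.
by move/divg1_eq/(canRL (mulgVK _)).
Qed.

Lemma stable_conj e k :
  hv [:: (None, e)] * hv (emb (wpow (assoc_word e) k)) =
  hv (emb (wpow (assoc_word (~~ e)) k)) * hv [:: (None, e)].
Proof.
have liftP w : hv (emb (wpow w k)) = expgz (hv (emb w)) k.
  rewrite -org_pi_wpow; congr org_pi; case: k => n.
    by elim: n => //= n IH; rewrite emb_cat IH.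
  have: emb (flatten (nseq n.+1 (word_inv w))) = flatten (nseq n.+1 (emb (word_inv w))).
    by elim: n.+1 => //= m IH; rewrite emb_cat IH.
  by rewrite emb_inv.
rewrite !liftP; apply: expgz_conj.
case: e => /=; [|exact: hnn_rel]; rewrite -[(None, true)]/(letter_inv (pos None)) org_pi_letter_inv.
by apply: (mulgI (hv [:: pos None])); rewrite mulVKg mulgA hnn_rel mulgK.
Qed.

(** * Britton reduction *)

Local Notation bstate := (word A * seq (bool * word A))%type.

Definition bword (s : bstate) : word (option A) :=
  emb s.1 ++ flatten [seq (None, x.1) :: emb x.2 | x <- s.2].

Lemma bword_cons v0 e v L :
  bword (v0, (e, v) :: L) = emb v0 ++ (None, e) :: bword (v, L).
Proof. by []. Qed.

Definition sgn_word (w : word A) (p : seq bool) : word A :=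
  flatten [seq (if b then word_inv w else w) | b <- p].

Definition sgn_sum (p : seq bool) : int :=
  (\sum_(b <- p) (if b then -1 else 1))%R.

Lemma org_pi_sgn_word r w p : org_pi r (sgn_word w p) = expgz (org_pi r w) (sgn_sum p).
Proof.
rewrite /sgn_sum; elim: p => [|b p IH]; first by rewrite big_nil.
rewrite big_cons /= org_pi_cat -/(sgn_word w p) IH expgzD.
by case: b; rewrite ?org_pi_inv.
Qed.

(** The exponents tried are sums of at most |v| signs, which is enough: a power
    of exponent k of a cyclically reduced word has length at least |k|. *)
Definition transport (w w' v : word A) : bool * word A :=
  foldr (fun p acc => if red (sgn_word w p) == red v then (true, sgn_word w' p) else acc)
    (false, [::]) (words_upto [:: false; true] (size v)).

Lemma transport_spec w w' v : cyc_reduced w ->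
  if (transport w w' v).1 then
    exists2 p, fv v = expgz (fv w) (sgn_sum p) & (transport w w' v).2 = sgn_word w' p
  else forall k, fv v <> expgz (fv w) k.
Proof.
move=> cw.
have nseqE b k : sgn_sum (nseq k b) = (if b then - k%:Z else k%:Z)%R.
  rewrite /sgn_sum; elim: k => [|k IH]; first by rewrite big_nil; case: b.
  by rewrite big_cons IH; case: b {IH}; lia.
have complete k : fv v = expgz (fv w) k -> exists2 p,
    p \in words_upto [:: false; true] (size v) & red (sgn_word w p) == red v.
  move=> vk; exists (nseq (absz k) (k < 0)%R).
    rewrite mem_words_upto size_nseq (cyc_reduced_size_pow cw vk) /=.
    by apply/allP => b _; case: b.
  apply/eqP/org_pi_red; rewrite org_pi_sgn_word vk nseqE; congr expgz.
  by case: ifP; lia.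
rewrite /transport; elim: (words_upto _ _) complete => [|p L IH] complete /=.
  by move=> k /complete [].
have [/eqP/org_pi_red E|np] := boolP (red (sgn_word w p) == red v).
  by exists p => //; rewrite -E org_pi_sgn_word.
apply: IH => k /complete[q]; rewrite inE => /orP[/eqP ->|qL qv]; last by exists q.
by rewrite (negPf np).
Qed.

Definition britton_push (l : letter (option A)) (s : bstate) : bstate :=
  if l.1 is Some a then (push_letter (a, l.2) s.1, s.2)
  else if s.2 is (e, v) :: L then
    let q := transport (assoc_word l.2) (assoc_word (~~ l.2)) s.1 in
    if (e == ~~ l.2) && q.1 then (red (q.2 ++ v), L) else ([::], (l.2, s.1) :: s.2)
  else ([::], [:: (l.2, s.1)]).

Definition britton_red (w : word (option A)) : bstate := foldr britton_push ([::], [::]) w.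

Fixpoint britton_reduced (L : seq (bool * word A)) : Prop :=
  if L is (e, v) :: L' then
    (ohead (unzip1 L') = Some (~~ e) -> forall k, fv v <> assoc_pow e k) /\ britton_reduced L'
  else True.

Lemma cyc_reduced_assoc e : cyc_reduced (assoc_word e).
Proof. by case: e. Qed.

Lemma britton_push_val l s : hv (bword (britton_push l s)) = hv (l :: bword s).
Proof.
case: l s => -[a|] b [v0 L]; rewrite /britton_push /=.
  rewrite /bword /= !org_pi_cat [RHS]org_pi_cons org_pi_cat mulgA; congr (_ * _).
  rewrite -[_ * _]org_pi_cat -[_ ++ _]/(emb ((a, b) :: v0)).
  by apply: emb_equiv; exact: push_letter_val.
case: L => [//|[e v] L].
have := transport_spec (assoc_word (~~ b)) v0 (cyc_reduced_assoc b).
case: (transport _ _ v0) => -[] q /=; last by rewrite andbF.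
move=> [p v0E ->]; rewrite andbT; case: eqP => // ->; clear e.
rewrite bword_cons org_pi_cons !org_pi_cat /= /bword /= -org_pi_cat mulgA.
have -> : hv (emb v0) = hv (emb (wpow (assoc_word b) (sgn_sum p))).
  by apply: emb_equiv; rewrite v0E org_pi_wpow.
rewrite stable_conj -mulgA -[(None, ~~ b)]/(letter_inv (None, b)).
rewrite [hv (_ :: emb v ++ _)]org_pi_cons org_pi_letter_inv mulVKg !org_pi_cat.
rewrite mulgA; congr (_ * _).
have -> : hv (emb (red (sgn_word (assoc_word (~~ b)) p ++ v))) =
    hv (emb (sgn_word (assoc_word (~~ b)) p ++ v)).
  by apply: emb_equiv; rewrite red_val.
rewrite emb_cat org_pi_cat; congr (_ * _); apply: emb_equiv.
by rewrite org_pi_sgn_word org_pi_wpow.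
Qed.

Lemma britton_red_val w : hv (bword (britton_red w)) = hv w.
Proof.
by elim: w => //= l w IH; rewrite britton_push_val [LHS]org_pi_cons IH -org_pi_cons.
Qed.

Lemma britton_red_reduced w : britton_reduced (britton_red w).2.
Proof.
elim: w => // -[[a|] b] w /=; rewrite /britton_push //=.
case: (britton_red w) => v0 [|[e v] L] //= [nv bL].
have := transport_spec (assoc_word (~~ b)) v0 (cyc_reduced_assoc b).
case: (transport _ _ v0) => -[] q /= E; last by rewrite andbF /=; split.
by rewrite andbT; case: eqP => //= nb; split=> // -[].
Qed.

Lemma britton_red_head w : reduced (britton_red w).1.
Proof.
elim: w => // -[[a|] b] w IH /=; rewrite /britton_push /=; first exact: push_letter_reduced.
case: (britton_red w).2 => [//|[e v] L]; case: ifP => // _; exact: red_reduced.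
Qed.

(** Pushing a stable letter onto the normal form of a Britton-reduced word
    never cancels, so normal form and word have the same stable letters. *)
Lemma nf_britton v0 L : britton_reduced L ->
  exists k l, nf (bword (v0, L)) =
    (fv v0 * (if L is (e, _) :: _ then assoc_pow (~~ e) k else 1), l) /\ unzip1 l = unzip1 L.
Proof.
elim: L v0 => [|[e v] L IH] v0 /= bL.
  exists 0%R, [::]; split=> //.
  by rewrite /bword /= nf_emb_cat /push_elt.
move: bL => [nv bL]; have [k [l [nfE lE]]] := IH v bL.
rewrite bword_cons nf_emb_cat -[nf (_ :: _)]/(pusht e (nf _)) nfE.
set f := fv v * _.
have [j fE] := rep_spec assoc_powD e f.
rewrite fE (push_tE assoc_powD assoc_pow_inj) ?(rep_id assoc_powD) //.
  by exists j, ((e, rep assoc_pow e f) :: l); rewrite /= lE.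
move=> /(rep1P assoc_powD)[i]; rewrite /f lE.
case: L nv {bL IH lE nfE fE f} => [//|[e1 v1] L] nv /= vE [e1E].
rewrite {e1}e1E in nv vE; case: (nv erefl (i - k)%R).
by rewrite assoc_powD (gamN assoc_powD) -vE negbK mulgK.
Qed.

(** Britton's lemma: a reduced word with a stable letter has one in its normal
    form, hence is not trivial. This solves the word problem. *)
Lemma britton_red_nil w : hv w = 1 <-> britton_red w = ([::], [::]).
Proof.
split=> [w1|E]; last by rewrite -britton_red_val E.
have : nf (bword (britton_red w)) = nf [::] by apply: nf_equiv; rewrite britton_red_val.
have := britton_red_head w; have := britton_red_reduced w; case: (britton_red w) => v0 L /= bL rv0.
have [k [l [-> lE]]] := nf_britton v0 bL.
move=> [+ l0]; rewrite {l}l0 in lE; case: L bL lE => // _ _.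
by rewrite mulg1 => /org_pi_red; rewrite reduced_red //= => ->.
Qed.

(** * Words in which the stable letter occurs only positively *)

Definition pword (v0 : word A) (vs : seq (word A)) : word (option A) :=
  bword (v0, [seq (false, v) | v <- vs]).

Lemma pword_cons v0 v vs : pword v0 (v :: vs) = emb v0 ++ pos None :: pword v vs.
Proof. by []. Qed.

Lemma pword_val q v0 v vs : org_pi q (pword v0 (v :: vs)) =
  org_pi q (emb v0) * (org_pi q [:: pos None] * org_pi q (pword v vs)).
Proof. by rewrite pword_cons org_pi_cat [X in _ * X]org_pi_cons. Qed.

(** u0 t u1 ... and h v0 t v1 ... are equal because of powers of d that move
    across the stable letters and become powers of c. *)
Fixpoint linked (h : F) (u0 : word A) (us : seq (word A)) v0 vs : Prop :=
  match us, vs with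
  | [::], [::] => fv u0 = h * fv v0
  | u1 :: us', v1 :: vs' => exists2 k : int,
      fv u0 = h * fv v0 * assoc_pow true k &
      linked (assoc_pow false (- k)%R) u1 us' v1 vs'
  | _, _ => False
  end.

Lemma unzip1_pword (us : seq (word A)) :
  unzip1 [seq (false, u) | u <- us] = nseq (size us) false.
Proof. by elim: us => //= u us ->. Qed.

Lemma britton_pos (us : seq (word A)) : britton_reduced [seq (false, u) | u <- us].
Proof. by elim: us => //= u us IH; split=> //; case: us {IH}. Qed.

Lemma nf_pword_cons u0 u us f l : nf (pword u us) = (f, l) ->
  nf (pword u0 (u :: us)) = (fv u0 * assoc_pow true (coef assoc_powD false f),
    (false, rep assoc_pow false f) :: l).
Proof.
move=> E; rewrite pword_cons nf_emb_cat -[nf (_ :: _)]/(pusht false (nf _)) E.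
rewrite [f in (f, l)](coefK assoc_powD false) (push_tE assoc_powD assoc_pow_inj) ?(rep_id assoc_powD) //.
move=> _; have [k [l' [+ lE]]] := nf_britton u (britton_pos us).
rewrite -/(pword u us) E => -[_ ->]; rewrite lE unzip1_pword.
by case: (size us).
Qed.

(** Positive words never cancel a stable letter, so their normal forms record
    the factors one by one up to powers of c and d. *)
Lemma nf_linked u0 us v0 vs f g l :
  nf (pword u0 us) = (f, l) -> nf (pword v0 vs) = (g, l) ->
  linked (f * g^-1) u0 us v0 vs.
Proof.
elim: us u0 vs v0 f g l => [|u us IH] u0 [|v vs] v0 f g l.
- rewrite /pword /bword /= !nf_emb_cat /push_elt /= !mulg1 => -[<- _] [<- _].
  by rewrite mulgVK.
- rewrite /pword /bword /= nf_emb_cat => -[_ <-].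
  case E : (nf (pword v vs)) => [f' l']; rewrite -/(pword v0 (v :: vs)).
  by move/(nf_pword_cons v0): E => ->.
- case E : (nf (pword u us)) => [f' l'].
  move/(nf_pword_cons u0): E => -> [_ <-].
  by rewrite /pword /bword /= nf_emb_cat.
case Eu : (nf (pword u us)) => [f' l']; case Ev : (nf (pword v vs)) => [g' l''].
rewrite (nf_pword_cons u0 Eu) (nf_pword_cons v0 Ev) => -[<- <-] [<- ff' ll'].
rewrite {}ll' in Ev; have := IH _ _ _ _ _ _ Eu Ev.
rewrite [f' in f' * _](coefK assoc_powD false) [g' in _ * g'^-1](coefK assoc_powD false).
rewrite ff'; set k := coef _ _ f'; set j := coef _ _ g'.
rewrite invgM mulgA mulgK -(gamN assoc_powD) -assoc_powD => lnk.
exists (j - k)%R => /=; last by rewrite GRing.opprB.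
rewrite assoc_powD invgM !mulgA (gamN assoc_powD).
by rewrite !mulgVK mulgK.
Qed.
End HNNWords.

(** * Computability of Britton reduction *)

Definition enc_word (A : finType) : word A -> nat := enc_seq (@enc_fin (letter A)).

Definition enc_bstate (A : finType) : word A * seq (bool * word A) -> nat :=
  enc_pair (@enc_word A) (enc_seq (enc_pair enc_bool (@enc_word A))).

Lemma enc_bool_inj : injective enc_bool.
Proof. by move=> [] []. Qed.

Lemma enc_word_inj (A : finType) : injective (@enc_word A).
Proof. exact: enc_seq_inj (@enc_fin_inj _). Qed.

Lemma enc_bstate_inj (A : finType) : injective (@enc_bstate A).
Proof.
apply: enc_pair_inj; first exact: enc_word_inj.
apply: enc_seq_inj; apply: enc_pair_inj; first exact: enc_bool_inj.
exact: enc_word_inj.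
Qed.

Lemma computable_finfun S (eS : S -> nat) (B : finType) T (eT : T -> nat) (f : B -> T) a :
  computable eS (@enc_fin B) a -> computable eS eT (fun s => f (a s)).
Proof.
move=> ca; apply: (computable_finite (F := fun b (_ : S) => f b) _ ca (computable_id _)).
by move=> b; exact: computable_const.
Qed.

Lemma computable_subst S (eS : S -> nat) (A B : finType) (f : A -> word B) w :
  computable eS (@enc_word A) w -> computable eS (@enc_word B) (fun s => subst f (w s)).
Proof.
move=> cw; apply: computable_flatten.
apply: (computable_map (f := fun=> subst_letter f)) cw.
exact: computable_finfun (computable_snd (computable_id _)).
Qed.

Section ComputableBritton.
Variables (A : finType).
Local Notation eL := (@enc_fin (letter A)).
Local Notation eW := (@enc_word A).
Local Notation eB := (@enc_bstate A).

Lemma computable_push_letter S (eS : S -> nat) l w :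
  computable eS eL l -> computable eS eW w ->
  computable eS eW (fun s => push_letter (l s) (w s)).
Proof.
move=> cl cw; apply: (computable_match (eE := eL)
  (g := fun s l' w' => if l' == letter_inv (l s) then w' else l s :: w s)
  (f := fun s => [:: l s]) (l := w)); last exact: cw.
  by apply: computable_cons => //; exact: computable_const.
have ci := computable_id (enc_pair eS (enc_pair eL eW)).
have c1 := computable_comp cl (computable_fst ci).
have c2 := computable_fst (computable_snd ci).
have c3 := computable_snd (computable_snd ci).
apply: computable_if; last 1 first.
- by apply: computable_cons => //; exact: computable_comp cw (computable_fst ci).
- apply: (computable_eq (eT := eL)) => //; first exact: enc_fin_inj.
  exact: (computable_finfun eL (@letter_inv A) c1).
- exact: c3.
Qed.

Lemma computable_red S (eS : S -> nat) w :
  computable eS eW w -> computable eS eW (fun s => red (w s)).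
Proof.
move=> cw; apply: (computable_foldr (f := fun=> @push_letter A)) cw; last exact: computable_const.
have ci := computable_id (enc_pair eS (enc_pair eL eW)).
apply: computable_push_letter; first exact: (computable_fst (computable_snd ci)).
exact: (computable_snd (computable_snd ci)).
Qed.

Lemma computable_sgn_word S (eS : S -> nat) (w : word A) p :
  computable eS (enc_seq enc_bool) p -> computable eS eW (fun s => sgn_word w (p s)).
Proof.
move=> cp; apply: computable_flatten.
apply: (computable_map (f := fun (_ : S) b => if b then word_inv w else w)) cp.
apply: computable_if; try exact: computable_const.
exact: computable_snd (computable_id _).
Qed.

Lemma computable_transport S (eS : S -> nat) (w w' : word A) v :
  computable eS eW v ->
  computable eS (enc_pair enc_bool eW) (fun s => transport w w' (v s)).
Proof.
move=> cv; have cwords := computable_words_upto enc_bool [:: false; true] cv.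
apply: (computable_foldr (f := fun s p acc =>
  if red (sgn_word w p) == red (v s) then (true, sgn_word w' p) else acc)) cwords;
  last exact: computable_const.
have ci := computable_id (enc_pair eS (enc_pair (enc_seq enc_bool) (enc_pair enc_bool eW))).
have cp := computable_fst (computable_snd ci).
apply: computable_if; last exact: (computable_snd (computable_snd ci)).
  apply: (computable_eq (eT := eW)); first exact: enc_word_inj.
    exact: computable_red (computable_sgn_word w cp).
  exact: computable_red (computable_comp cv (computable_fst ci)).
apply: computable_pair; first exact: computable_const.
exact: computable_sgn_word.
Qed.

Lemma computable_britton_push (c d : word A) l :
  computable eB eB (britton_push c d l).
Proof.
have ci := computable_id eB.
case: l => -[a|] b; rewrite /britton_push /=.
  apply: computable_pair; last exact: computable_snd ci.
  apply: computable_push_letter; first exact: computable_const.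
  exact: computable_fst ci.
apply: (computable_ext (f := fun s : word A * seq (bool * word A) =>
  if s.2 is x :: L then
    let q := transport (assoc_word c d b) (assoc_word c d (~~ b)) s.1 in
    if (x.1 == ~~ b) && q.1 then (red (q.2 ++ x.2), L) else ([::], (b, s.1) :: s.2)
  else ([::], [:: (b, s.1)]))); last by move=> [v0 [|[e v] L]].
apply: (computable_match (eE := enc_pair enc_bool eW)
  (f := fun s => ([::], [:: (b, s.1)])) (l := snd)
  (g := fun s x L =>
    let q := transport (assoc_word c d b) (assoc_word c d (~~ b)) s.1 in
    if (x.1 == ~~ b) && q.1 then (red (q.2 ++ x.2), L) else ([::], (b, s.1) :: s.2)));
  last exact: computable_snd ci.
- apply: computable_pair; first exact: computable_const.
  apply: computable_cons; last exact: computable_const.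
  apply: computable_pair; first exact: computable_const.
  exact: computable_fst ci.
- have cj := computable_id (enc_pair eB (enc_pair (enc_pair enc_bool eW)
     (enc_seq (enc_pair enc_bool eW)))).
  have cv := computable_fst (computable_fst cj).
  have cx := computable_fst (computable_snd cj).
  have cq := computable_transport (assoc_word c d b) (assoc_word c d (~~ b)) cv.
  apply: computable_if.
  + apply: computable_if; last exact: computable_const.
      apply: (computable_eq (eT := enc_bool)); first exact: enc_bool_inj.
        exact: computable_fst cx.
      exact: computable_const.
    exact: computable_fst cq.
  + apply: computable_pair; last exact: (computable_snd (computable_snd cj)).
    apply: computable_red; apply: computable_cat; first exact: computable_snd cq.
    exact: computable_snd cx.
  + apply: computable_pair; first exact: computable_const.
    apply: computable_cons; last exact: computable_snd (computable_fst cj).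
    by apply: computable_pair; first exact: computable_const.
Qed.

Lemma computable_britton_red S (eS : S -> nat) (c d : word A) w :
  computable eS (@enc_word (option A)) w -> computable eS eB (fun s => britton_red c d (w s)).
Proof.
move=> cw; apply: (computable_foldr (f := fun=> britton_push c d)) cw; last exact: computable_const.
have ci := computable_id (enc_pair eS (enc_pair (@enc_fin (letter (option A))) eB)).
apply: (computable_finite (eU := eB) (F := britton_push c d) (g := fun p => p.2.2)).
- exact: computable_britton_push.
- exact: (computable_fst (computable_snd ci)).
- exact: (computable_snd (computable_snd ci)).
Qed.

End ComputableBritton.

(** * Linking powers *)

Section Chains.
Variables (A : finType) (c d : word A).
Implicit Types (u v : word A) (us vs : seq (word A)) (k l : int).

Local Notation fv := (org_pi [::]).
Local Notation hv := (org_pi (hnn_relator c d)).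

(** The reduced form of an element that is represented by a positive word is
    itself positive, stable letters being preserved by normal forms. *)
Lemma linked_britton_red (cyc_c : cyc_reduced c) (cyc_d : cyc_reduced d) w u0 us :
  hv w = hv (pword u0 us) ->
  exists v0 vs, britton_red c d w = (v0, [seq (false, v) | v <- vs]) /\ linked c d 1 u0 us v0 vs.
Proof.
move=> wE; have nfE : nf c d (bword (britton_red c d w)) = nf c d (pword u0 us).
  by apply: (nf_equiv cyc_c cyc_d); rewrite (britton_red_val cyc_c cyc_d).
have [k [l [E lE]]] := nf_britton cyc_c cyc_d u0 (britton_pos c d us).
have := britton_red_reduced cyc_c cyc_d w; case brE : (britton_red c d w) nfE => [v0 L] /= nfE bL.
have [k' [l' [E' lE']]] := nf_britton cyc_c cyc_d v0 bL.
have := nfE; rewrite E' E => -[_ ll']; move: lE'; rewrite ll' lE unzip1_pword => LE.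
have LE' : L = [seq (false, v) | v <- unzip2 L].
  elim: L (size us) LE {brE nfE bL E'} => [//|[e v] L IH] [|n] //= [<- /IH {1}->].
  by [].
exists v0, (unzip2 L); rewrite -LE'; split=> //.
case nE : (nf c d (pword u0 us)) => [f m].
rewrite -(mulgV f); apply: (nf_linked cyc_c cyc_d nE).
by rewrite /pword -LE' nfE nE.
Qed.

Lemma linked_val k u0 us v0 vs : linked c d (assoc_pow c d false k) u0 us v0 vs ->
  hv (pword u0 us) = hv (emb (wpow c k)) * hv (pword v0 vs).
Proof.
have liftE k' u v l :
    fv u = assoc_pow c d false k' * fv v * assoc_pow c d true l ->
    hv (emb u) = hv (emb (wpow c k')) * hv (emb v) * hv (emb (wpow d l)).
  move=> uE; rewrite -!org_pi_cat -!emb_cat; apply: emb_equiv.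
  by rewrite uE !org_pi_cat !org_pi_wpow.
elim: us k u0 v0 vs => [|u us IH] k u0 v0 [|v vs] //=.
  move=> uE; rewrite /pword /bword /= !cats0.
  by rewrite (liftE k u0 v0 0%R) ?uE /= ?mulg1.
move=> [l /liftE uE /IH lnk]; rewrite !pword_cons !org_pi_cat uE.
rewrite [hv (_ :: pword u us)]org_pi_cons [hv (_ :: pword v vs)]org_pi_cons lnk.
have cancel x : hv (emb (wpow d l)) * (hv [:: pos None] * (hv (emb (wpow c (- l)%R)) * x)) =
    hv [:: pos None] * x.
  have -> : hv [:: pos None] * (hv (emb (wpow c (- l)%R)) * x) =
      hv (emb (wpow d (- l)%R)) * (hv [:: pos None] * x).
    by rewrite mulgA (stable_conj c d false (- l)%R) mulgA.
  rewrite mulgA -[hv (emb (wpow d l)) * _]org_pi_cat -emb_cat.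
  suff -> : hv (emb (wpow d l ++ wpow d (- l)%R)) = hv (emb [::]) by rewrite mul1g.
  by apply: emb_equiv; rewrite org_pi_cat !org_pi_wpow -expgzD GRing.subrr.
by rewrite -!mulgA cancel.
Qed.

Variables okm okl : word A -> Prop.
Hypothesis okm_red : forall u, okm u -> okm (red u).
Hypothesis okl_red : forall u, okl u -> okl (red u).

(** okm and okl describe the factors, before a stable letter and at the end, of
    the positive words that come from products of generators. *)
Fixpoint admissible u0 us : Prop :=
  if us is u :: us' then okm u0 /\ admissible u us' else okl u0.

Definition shifted v k l : word A := red (wpow c (- k)%R ++ v ++ wpow d l).

(** The word v0 t v1 ... becomes admissible when stable letters t are rewritten
    as d^l t c^(-l), for exponents l that satisfy P. *)
Fixpoint chain (P : int -> Prop) k v0 vs : Prop :=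
  if vs is v :: vs' then
    exists l, [/\ P l, okm (shifted v0 k l) & chain P l v vs']
  else okl (shifted v0 k 0%R).

Definition weight v0 vs : nat := size v0 + sumn [seq (size v).+1 | v <- vs].

Lemma weight_cons v0 v vs : weight v0 (v :: vs) = (size v0 + (weight v vs).+1)%N.
Proof. by []. Qed.

Lemma shifted_val v k l :
  fv (shifted v k l) = assoc_pow c d false (- k)%R * fv v * assoc_pow c d true l.
Proof. by rewrite red_val !org_pi_cat !org_pi_wpow mulgA. Qed.

Lemma linked_chain k u0 us v0 vs :
  linked c d (assoc_pow c d false (- k)%R) u0 us v0 vs -> admissible u0 us ->
  chain (fun=> True) k v0 vs.
Proof.
have redE u v k' l : fv u = assoc_pow c d false (- k')%R * fv v * assoc_pow c d true l ->
    red u = shifted v k' l.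
  move=> uE; rewrite -[RHS]reduced_red ?red_reduced //.
  by apply/org_pi_red; rewrite shifted_val.
elim: us k u0 v0 vs => [|u us IH] k u0 v0 [|v vs] //=.
  by move=> uE /okl_red; rewrite (redE _ v0 k 0%R) // uE mulg1.
move=> [l uE lnk] [/okm_red ok ad]; exists l; split=> //.
  by rewrite -(redE _ _ _ _ uE).
exact: IH lnk ad.
Qed.

Lemma size_wpow (w : word A) k : size (wpow w k) = (absz k * size w)%N.
Proof.
case: k => n; first exact: size_flatten_nseq.
by rewrite /wpow size_flatten_nseq size_rev size_map.
Qed.

(** Linking powers bounded by N give admissible factors of bounded length: this
    is what limits the search for a word over the generators. *)
Lemma chain_linked N k v0 vs : absz k <= N -> chain (fun l => absz l <= N) k v0 vs ->
  exists u0 us, [/\ linked c d (assoc_pow c d false (- k)%R) u0 us v0 vs, admissible u0 us &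
    weight u0 us <= weight v0 vs + (size vs).+1 * (N * (size c + size d))].
Proof.
have szE v k' l : absz k' <= N -> absz l <= N ->
    size (shifted v k' l) <= size v + N * (size c + size d).
  move=> kN lN; apply: (leq_trans (size_red _)).
  rewrite !size_cat !size_wpow abszN.
  have := leq_mul kN (leqnn (size c)); have := leq_mul lN (leqnn (size d)).
  by rewrite mulnDr; lia.
elim: vs k v0 => [|v vs IH] k v0 kN /=.
  move=> ok; exists (shifted v0 k 0%R), [::]; split=> //.
    by rewrite /= shifted_val /assoc_pow expgz0 mulg1.
  by rewrite /weight /= !addn0 mul1n; apply: szE.
move=> [l [lN ok /(IH _ _ lN)[u [us [lnk ad wt]]]]].
exists (shifted v0 k l), (u :: us); split=> //.
  by exists l => //; exact: shifted_val.
rewrite !weight_cons; have := szE v0 k l kN lN; move: wt.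
by rewrite [((size vs).+2 * _)%N]mulSn; lia.
Qed.

End Chains.

(** * Deciding membership by bounded search *)

Definition submonoid_words (A : finType) (r : word A) (X : {set letter A}) : set (word A) :=
  [set w | exists2 x, all (mem X) x & word_equiv r x w].

(** The one-relator group of r is embedded in an HNN extension by sigma, with
    left inverse tau. If words over X correspond to admissible positive words, and
    linking powers can be bounded, then w is in the submonoid exactly when it is
    represented by a word over X whose length is bounded in terms of the Britton
    reduction of w; all these words are tried. *)
Section Search.
Variables (A : finType) (r : word A) (X : {set letter A}) (c d : word A).
Hypotheses (cyc_c : cyc_reduced c) (cyc_d : cyc_reduced d).
Variables (sigma : A -> word (option A)) (tau : option A -> word A).
Local Notation hv := (org_pi (hnn_relator c d)).

Hypothesis sigma_r : hv (subst sigma r) = 1.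
Hypothesis tau_rel : org_pi r (subst tau (hnn_relator c d)) = 1.
Hypothesis tauK : forall a, org_pi r (subst tau (sigma a)) = org_pi r [:: pos a].

Lemma subst_tauK u : org_pi r (subst tau (subst sigma u)) = org_pi r u.
Proof.
elim: u => // -[a b] u IH.
rewrite subst_cons subst_cat org_pi_cat IH [RHS]org_pi_cons; congr (_ * _).
rewrite /subst_letter /=; case: b; last exact: tauK.
by rewrite subst_inv org_pi_inv tauK -[(a, true)]/(letter_inv (pos a)) org_pi_letter_inv.
Qed.

Lemma embedding u v : org_pi r u = org_pi r v <-> hv (subst sigma u) = hv (subst sigma v).
Proof.
split=> /org_pi_eq uv; first by apply/org_pi_eq; apply: subst_equiv uv; apply/org_pi_eq.
rewrite -subst_tauK -(subst_tauK v); apply/org_pi_eq; apply: subst_equiv uv.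
exact/org_pi_eq.
Qed.

Variables okm okl : word A -> Prop.
Hypothesis okm_red : forall u, okm u -> okm (red u).
Hypothesis okl_red : forall u, okl u -> okl (red u).
Variable K : nat.

Hypothesis over_admissible : forall x, all (mem X) x ->
  exists u0 us, hv (subst sigma x) = hv (pword u0 us) /\ admissible okm okl u0 us.

Hypothesis admissible_over : forall u0 us, admissible okm okl u0 us ->
  exists x, [/\ all (mem X) x, hv (subst sigma x) = hv (pword u0 us) &
    size x <= K * (weight u0 us).+1].

Hypothesis chain_bounded : forall v0 vs,
  chain c d okm okl (fun=> True) 0 v0 vs ->
  chain c d okm okl (fun l => absz l <= weight v0 vs) 0 v0 vs.

(** The bound is computed in unary, as the length of a list. *)
Definition unary_weight (s : word A * seq (bool * word A)) : seq unit :=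
  tt :: [seq tt | _ <- s.1] ++ flatten [seq tt :: [seq tt | _ <- x.2] | x <- s.2].

Definition unary_mul (p q : seq unit) : seq unit := flatten [seq q | _ <- p].

Lemma size_unary_mul p q : size (unary_mul p q) = (size p * size q)%N.
Proof. by elim: p => //= x p IH; rewrite size_cat IH mulSn. Qed.

Lemma size_unary_weight v0 vs :
  size (unary_weight (v0, [seq (false, v) | v <- vs])) = (weight v0 vs).+1.
Proof.
rewrite /unary_weight /weight /= size_cat size_map; congr (_ + _).+1.
by elim: vs => //= v vs IH; rewrite size_cat IH size_map.
Qed.

Definition search_bound (w : word A) : seq unit :=
  let p := unary_weight (britton_red c d (subst sigma w)) in
  unary_mul (nseq (K * (size c + size d).+1) tt) (unary_mul p p).

(** A word y over the inverses of X with y w = 1 is the inverse of a word over X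
    that represents w. *)
Definition search (w : word A) : bool :=
  has (fun y => britton_red c d (subst sigma (y ++ w)) == ([::], [::]))
    (words_upto [seq letter_inv l | l <- enum X] (size (search_bound w))).

Lemma short_witness w x : all (mem X) x -> org_pi r x = org_pi r w ->
  exists x', [/\ all (mem X) x', org_pi r x' = org_pi r w & size x' <= size (search_bound w)].
Proof.
move=> xX /embedding xw; have [u0 [us [xE ad]]] := over_admissible xX.
have [v0 [vs [brE lnk]]] := linked_britton_red cyc_c cyc_d (etrans (esym xw) xE).
have /chain_bounded ch : chain c d okm okl (fun=> True) 0 v0 vs.
  by apply: (linked_chain okm_red okl_red (k := 0%R)) ad.
have [u0' [us' [lnk' ad' wt]]] := chain_linked (k := 0%R) (leq0n (weight v0 vs)) ch.
have [x' [x'X x'E sx']] := admissible_over ad'.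
exists x'; split=> //.
  apply/embedding; rewrite x'E (linked_val (k := 0%R) lnk') mul1g.
  by rewrite -(britton_red_val cyc_c cyc_d (subst sigma w)) brE.
apply: (leq_trans sx'); rewrite /search_bound !size_unary_mul size_nseq brE size_unary_weight.
rewrite -mulnA leq_mul2l; apply/orP; right.
have : size vs <= weight v0 vs.
  by rewrite /weight; elim: (vs) => //= v vs1 IH; lia.
by move: wt; set W := weight _ _; set M := size c + size d; nia.
Qed.

Lemma searchP w : submonoid_words r X w <-> search w.
Proof.
split=> [[x xX /org_pi_eq xw]|/hasP[y]].
  have [x' [x'X x'w sx']] := short_witness xX xw.
  apply/hasP; exists (word_inv x').
    rewrite mem_words_upto size_rev size_map sx' all_rev all_map.
    by apply: sub_all x'X => l lX /=; rewrite map_f // mem_enum.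
  apply/eqP/(britton_red_nil cyc_c cyc_d); rewrite -[RHS]/(hv (subst sigma [::])).
  by apply/embedding; rewrite org_pi_cat org_pi_inv x'w mulVg.
rewrite mem_words_upto => /andP[_ yX] /eqP/(britton_red_nil cyc_c cyc_d).
rewrite -[1]/(hv (subst sigma [::])) => /embedding; rewrite org_pi_cat => yw.
exists (word_inv y).
  rewrite all_rev all_map; apply: sub_all yX => l /mapP[l' lX ->] /=.
  by rewrite letter_invK -mem_enum.
by apply/org_pi_eq; rewrite org_pi_inv; exact: mulg1_eq.
Qed.

Lemma computable_search : computable (@enc_word A) enc_bool search.
Proof.
have ci := computable_id (@enc_word A).
have cbound : computable (@enc_word A) (enc_seq (fun _ : unit => 0)) search_bound.
  have cmul S (eS : S -> nat) p q : computable eS (enc_seq (fun=> 0)) p ->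
      computable eS (enc_seq (fun=> 0)) q ->
      computable eS (enc_seq (fun=> 0)) (fun s => unary_mul (p s) (q s)).
    move=> cp cq; apply: computable_flatten.
    apply: (computable_map (f := fun s _ => q s)) cp.
    exact: computable_comp cq (computable_fst (computable_id _)).
  have cones S (eS : S -> nat) T (eT : T -> nat) l : computable eS (enc_seq eT) l ->
      computable eS (enc_seq (fun=> 0)) (fun s => [seq tt | _ <- l s]).
    move=> cl; apply: (computable_map (f := fun _ _ => tt)) cl.
    exact: computable_const.
  have cb := computable_britton_red c d (computable_subst sigma ci).
  apply: (cmul _ _ (fun=> _)); first exact: computable_const.
  suff cw : computable (@enc_word A) (enc_seq (fun=> 0))
      (fun w => unary_weight (britton_red c d (subst sigma w))) by exact: cmul.
  apply: computable_cons; first exact: computable_const.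
  apply: computable_cat; first exact: cones (computable_fst cb).
  apply: computable_flatten.
  apply: (computable_map (f := fun _ x => tt :: [seq tt | _ <- x.2])) (computable_snd cb).
  apply: computable_cons; first exact: computable_const.
  exact: cones (computable_snd (computable_snd (computable_id _))).
apply: (computable_has (eT := @enc_word A) (p := fun w y => britton_red c d (subst sigma (y ++ w)) == ([::], [::])));
  last exact: (computable_words_upto (@enc_fin (letter A)) _ cbound).
have cj := computable_id (enc_pair (@enc_word A) (@enc_word A)).
apply: (computable_eq (eT := @enc_bstate A)); first exact: enc_bstate_inj.
  apply: computable_britton_red; apply: computable_subst.
  apply: computable_cat; first exact: computable_snd cj.
  exact: computable_fst cj.
exact: computable_const.
Qed.

Theorem submonoid_decidable : decidable_language (submonoid_words r X).
Proof. exact: decidable_computable computable_search searchP. Qed.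

End Search.

(** * Bounding the powers that link two words *)

Section Exponents.
Variable A : finType.
Implicit Types (l : letter A) (u v w : word A).

Definition expsum l w : int :=
  ((count_mem l w)%:Z - (count_mem (letter_inv l) w)%:Z)%R.

Lemma expsum_cat l u v : expsum l (u ++ v) = (expsum l u + expsum l v)%R.
Proof. by rewrite /expsum !count_cat; lia. Qed.

Lemma expsum_inv l w : expsum l (word_inv w) = (- expsum l w)%R.
Proof.
have E l' : count_mem l' (word_inv w) = count_mem (letter_inv l') w.
  rewrite count_rev count_map; apply: eq_count => x /=.
  by rewrite (inv_eq (@letter_invK A)).
by rewrite /expsum !E letter_invK; lia.
Qed.

Lemma expsum_letter l : expsum l [:: l] = 1%R.
Proof.
by rewrite /expsum /= eqxx [_ == letter_inv _]eq_sym (negPf (letter_inv_neq _)).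
Qed.

Lemma expsum_letter_inv l : expsum l [:: letter_inv l] = (-1)%R.
Proof. by rewrite -[[:: _]]/(word_inv [:: l]) expsum_inv expsum_letter. Qed.

Lemma expsum_push_letter l l' w : expsum l (push_letter l' w) = expsum l (l' :: w).
Proof.
case: w => //= l1 w; case: eqP => // ->; rewrite /expsum /=.
rewrite -!(inv_eq (@letter_invK A)) !letter_invK (inv_eq (@letter_invK A)).
by case: (l' == l); case: (l' == letter_inv l); lia.
Qed.

Lemma expsum_red l w : expsum l (red w) = expsum l w.
Proof.
elim: w => // l' w IH; rewrite /= expsum_push_letter.
by rewrite -cat1s expsum_cat IH -expsum_cat.
Qed.

Lemma expsum_wpow l w k : expsum l (wpow w k) = (k * expsum l w)%R.
Proof.
have H n w' : expsum l (flatten (nseq n w')) = (n%:Z * expsum l w')%R.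
  elim: n => [|n IH]; first by rewrite GRing.mul0r.
  by rewrite [flatten _]/(w' ++ flatten _) expsum_cat IH; lia.
by case: k => n; rewrite /wpow H ?expsum_inv; lia.
Qed.

Lemma expsum_size l w : absz (expsum l w) <= size w.
Proof.
have : (count_mem l w + count (predC (pred1 l)) w)%N = size w := count_predC _ _.
have : count_mem (letter_inv l) w <= count (predC (pred1 l)) w.
  by apply: sub_count => x /= /eqP ->; exact: letter_inv_neq.
by rewrite /expsum; lia.
Qed.

Lemma expsum_ge0 l w : letter_inv l \notin w -> (0 <= expsum l w)%R.
Proof. by move=> /count_memPn; rewrite /expsum => ->; lia. Qed.

Lemma expsum_eq0 l w : l \notin w -> letter_inv l \notin w -> expsum l w = 0%R.
Proof. by move=> /count_memPn + /count_memPn; rewrite /expsum => -> ->. Qed.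

End Exponents.

Section ChainBounds.
Variables (A : finType) (c d : word A) (okm okl : word A -> Prop).
Implicit Types (v : word A) (vs : seq (word A)) (k l : int).

Local Notation chn := (chain c d okm okl).

Lemma expsum_shifted x v k l : expsum x (shifted c d v k l) =
  (- k * expsum x c + expsum x v + l * expsum x d)%R.
Proof. by rewrite expsum_red !expsum_cat !expsum_wpow GRing.addrA. Qed.

(** The linking powers are zero at both ends of the word; if in between they
    are monotone up to the lengths of the factors, then they are bounded. *)
Lemma chain_bounded_monotone (e : int) : absz e = 1%N ->
  (forall v k l, okm (shifted c d v k l) -> (e * k <= e * l + (size v)%:Z)%R) ->
  (forall v k, okl (shifted c d v k 0) -> (e * k <= (size v)%:Z)%R) ->
  forall v0 vs, chn (fun=> True) 0 v0 vs -> chn (fun l => absz l <= weight v0 vs) 0 v0 vs.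
Proof.
move=> e1 pm pl.
have upper k v vs : chn (fun=> True) k v vs -> (e * k <= (weight v vs)%:Z)%R.
  elim: vs k v => [|v1 vs IH] k v /=; first by move/pl; rewrite /weight /= addn0.
  by move=> [l [_ /pm + /IH]]; rewrite weight_cons; lia.
suff H N k v vs : weight v vs <= N -> ((weight v vs)%:Z - e * k <= N%:Z)%R ->
    chn (fun=> True) k v vs -> chn (fun l => absz l <= N) k v vs.
  by move=> v0 vs; apply: H; lia.
elim: vs k v => [|v1 vs IH] k v //=.
rewrite weight_cons => vN kN [l [_ ok ch]]; exists l.
have := upper _ _ _ ch; have := pm _ _ _ ok => h1 h2.
split=> //; last by apply: IH ch; lia.
have [E|E] : (e = 1 \/ e = -1)%R by lia.
  by rewrite E in h1 h2 kN; lia.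
by rewrite E in h1 h2 kN; lia.
Qed.

(** Exponent sums turn a bound on the linking power after a factor into a bound
    on the one before it, starting from the end of the word. *)
Lemma chain_bounded_small x :
  absz (expsum x c) = 1%N -> absz (expsum x d) <= 1%N ->
  (forall u, okm u -> absz (expsum x u) <= 1%N) -> (forall u, okl u -> expsum x u = 0%R) ->
  forall v0 vs, chn (fun=> True) 0 v0 vs -> chn (fun l => absz l <= weight v0 vs) 0 v0 vs.
Proof.
move=> xc xd pm pl.
have upper k v vs : chn (fun=> True) k v vs -> absz k <= weight v vs.
  elim: vs k v => [|v1 vs IH] k v /=.
    move/pl; rewrite expsum_shifted /weight /=.
    by have := expsum_size x v; nia.
  move=> [l [_ /pm + /IH]]; rewrite expsum_shifted weight_cons.
  by have := expsum_size x v; nia.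
suff H N k v vs : weight v vs <= N -> chn (fun=> True) k v vs ->
    chn (fun l => absz l <= N) k v vs.
  by move=> v0 vs; apply: H.
elim: vs k v => [|v1 vs IH] k v //=.
rewrite weight_cons => vN [l [_ ok ch]]; exists l.
have := upper _ _ _ ch; split=> //; first by lia.
by apply: IH ch; lia.
Qed.

(** When powers of c are units for the admissible factors, the linking power at
    the front of a factor imposes nothing on that factor, so that each linking
    power can be shortened independently of the others. *)
Lemma chain_bounded_free :
  (forall v k k' l, okm (shifted c d v k l) -> okm (shifted c d v k' l)) ->
  (forall v k k' l, okl (shifted c d v k l) -> okl (shifted c d v k' l)) ->
  (forall v k l, okm (shifted c d v k l) ->
     exists2 l', absz l' <= size v & okm (shifted c d v k l')) ->
  forall v0 vs, chn (fun=> True) 0 v0 vs -> chn (fun l => absz l <= weight v0 vs) 0 v0 vs.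
Proof.
move=> um ul short.
suff H N k k' v vs : weight v vs <= N -> chn (fun=> True) k v vs ->
    chn (fun l => absz l <= N) k' v vs.
  by move=> v0 vs; apply: H.
elim: vs k k' v => [|v1 vs IH] k k' v /=; first by move=> _; exact: ul.
rewrite weight_cons => vN [l [_ /short[l' sl' ok] ch]]; exists l'.
by split; [lia|exact: um ok|apply: IH ch; lia].
Qed.

(** Cancellation between v and d^l stops within the first |v| copies of d, and
    the remaining copies stay as they are. *)
Lemma shifted_prefix v l : cyc_reduced d ->
  exists2 l' : int, absz l' <= size v &
    exists s, shifted c d v 0 l = shifted c d v 0 l' ++ s.
Proof.
move=> cd; have [ls|ls] := leqP (absz l) (size v).
  by exists l => //; exists [::]; rewrite cats0.
have E w m n : cyc_reduced w -> size v <= n ->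
    red (v ++ flatten (nseq (n + m) w)) = red (v ++ flatten (nseq n w)) ++ flatten (nseq m w).
  move=> cw vn; have rw i : red (flatten (nseq i w)) = flatten (nseq i w).
    by rewrite reduced_red ?cyc_reduced_pow.
  rewrite !red_cat !rw nseqD flatten_cat foldr_push_letter_cat // size_flatten_nseq.
  by case/andP: cw => w0 _; rewrite (leq_trans vn) // leq_pmulr // lt0n size_eq0.
have sE k : shifted c d v 0 k = red (v ++ wpow d k) by [].
case: l ls => n /= ls.
  exists (Posz (size v)) => //; exists (flatten (nseq (n - size v) d)).
  by rewrite !sE /= -E // subnKC // ltnW.
case sv : (size v) => [|m].
  exists 0%R => //; exists (red (wpow d (Negz n))).
  by rewrite !sE /= (size0nil sv).
exists (Negz m) => //; exists (flatten (nseq (n - m) (word_inv d))).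
rewrite !sE -E ?sv // ?cyc_reduced_inv //.
by rewrite [wpow d (Negz n)]/wpow addSn subnKC //; lia.
Qed.

End ChainBounds.

(** * Changing the presentation *)

Lemma decidable_language_ext (A : finType) (L L' : set (word A)) :
  (forall w, L w <-> L' w) -> decidable_language L -> decidable_language L'.
Proof.
by move=> LL' [f rf fL]; exists f => // w; rewrite fL (asbool_equiv_eq (LL' w)).
Qed.

(** Inversion maps the submonoid of X to that of the inverses of X. *)
Lemma submonoid_words_inv (A : finType) (r : word A) (X : {set letter A}) :
  decidable_language (submonoid_words r [set l | letter_inv l \in X]%SET) ->
  decidable_language (submonoid_words r X).
Proof.
move=> /computable_decidable cX; have ci := computable_id (@enc_word A).
have cinv : computable (@enc_word A) (@enc_word A) (@word_inv A).
  apply: computable_rev; apply: (computable_map (f := fun=> @letter_inv A)) ci.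
  exact: computable_finfun (computable_snd (computable_id _)).
apply: decidable_computable (computable_comp cX cinv) _ => w.
suff H (Y : {set letter A}) u : submonoid_words r Y u ->
    submonoid_words r [set l | letter_inv l \in Y]%SET (word_inv u).
  split=> [/H /asboolP //|/asboolP /H]; rewrite word_invK.
  case=> x xX xw; exists x => //; apply: sub_all xX => l.
  by rewrite !inE letter_invK.
move=> [x xY xu]; exists (word_inv x); last exact: word_equiv_inv.
by rewrite all_rev all_map; apply: sub_all xY => l /=; rewrite inE letter_invK.
Qed.

Lemma submonoid_words_rot (A : finType) (p q : word A) (X : {set letter A}) :
  decidable_language (submonoid_words (q ++ p) X) ->
  decidable_language (submonoid_words (p ++ q) X).
Proof.
apply: decidable_language_ext => w; split=> -[x xX xw]; exists x => //;
  exact: word_equiv_rot.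
Qed.

Lemma submonoid_words_all (A : finType) (r : word A) (X : {set letter A}) :
  (forall l, submonoid_words r X [:: l]) -> decidable_language (submonoid_words r X).
Proof.
move=> allX; apply: (decidable_computable (b := fun=> true)).
  exact: computable_const.
move=> w; split=> // _; elim: w => [|l w [x xX xw]].
  by exists [::] => //; exact: word_equiv_refl.
have [y yX yl] := allX l; exists (y ++ x); first by rewrite all_cat yX.
exact: word_equiv_cat yl xw.
Qed.

(** The elements of the submonoid are the values of words over X, so membership
    is a question about words. *)
Lemma magnus_decidable (A : finType) (r : word A) :
  (forall X : {set letter A},
     (exists a, ~~ ([set pos a; letter_inv (pos a)]%SET \subset X)) ->
     decidable_language (submonoid_words r X)) ->
  forall M, magnus_submonoid r M -> membership_decidable (org_gen r) M.
Proof.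
move=> dec M [X [[a [_ aX]] ->]].
apply: decidable_language_ext (dec X _); last by exists a.
have letterE l : letter_val (org_gen r) l = org_pi r [:: l].
  by case: l => b [] //=; rewrite /letter_val /= -org_pi_letter_inv.
move=> w; rewrite /= word_val_org; split.
  move=> [x xX /org_pi_eq <-] N [[N1 NM] XN].
  elim: x xX => [_|l x IH /= /andP[lX /IH Nx]]; first exact: N1.
  rewrite org_pi_cons; apply: NM => //; apply: XN => /=.
  by exists l => //; rewrite letterE.
move=> /(_ (fun g => exists2 x, all (mem X) x & org_pi r x = g)) [].
- split; last first.
    move=> g [l lX <-]; exists [:: l]; rewrite ?letterE //=.
    by rewrite andbT.
  split; first by exists [::].
  move=> g h [x xX <-] [y yX <-]; exists (x ++ y); first by rewrite all_cat xX.
  by rewrite org_pi_cat.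
- by move=> x xX /org_pi_eq; exists x.
Qed.

(** * Orientable surface groups *)

(** The relator has the form t c t^-1 D with c a letter, and t^-1 is not among the
    generators: the group is an HNN extension with stable letter t, and words over
    the generators are positive. *)
Section LetterStable.
Variables (A : finType) (x y : A) (s : bool) (D : word A) (X : {set letter A}).
Hypotheses (yx : y != x) (Dx : all (fun l => l.1 != x) D) (cycD : cyc_reduced D).
Hypotheses (expD : expsum (y, s) D = (-1)%R) (xX : (x, true) \notin X).

Local Notation c := [:: (y, s)].
Local Notation d := (word_inv D).
Local Notation r := (pos x :: (y, s) :: (x, true) :: D).
Local Notation hv := (org_pi (hnn_relator c d)).

Definition letter_sigma (a : A) : word (option A) :=
  if a == x then [:: pos None] else [:: pos (Some a)].

Definition letter_tau (o : option A) : word A := [:: pos (odflt x o)].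

Lemma letter_sigma_emb u : all (fun l => l.1 != x) u -> subst letter_sigma u = emb u.
Proof.
elim: u => // -[a b] u IH /= /andP[ax ux].
by rewrite subst_cons IH // /subst_letter /letter_sigma /= (negPf ax); case: b.
Qed.

Lemma letter_tau_emb u : subst letter_tau (emb u) = u.
Proof. by elim: u => // -[a []] u IH; rewrite /= subst_cons IH. Qed.

Definition base_letters : {set letter A} := X :\ pos x.

Let okl u : Prop := all (mem base_letters) u.
Let okm u : Prop := pos x \in X /\ all (mem base_letters) u.

Lemma base_letterP l : l \in base_letters -> l.1 != x /\ l \in X.
Proof.
rewrite !inE => /andP[lx lX]; split=> //; apply: contraNneq xX => l1.
by case: l l1 lx lX => a [] /= -> //; rewrite eqxx.
Qed.

Lemma all_red (Y : {set letter A}) u : all (mem Y) u -> all (mem Y) (red u).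
Proof. by move/allP=> uY; apply/allP => l /sub_red /uY. Qed.

Lemma letter_over_admissible u : all (mem X) u ->
  exists u0 us, hv (subst letter_sigma u) = hv (pword u0 us) /\ admissible okm okl u0 us.
Proof.
elim: u => [_|l u IH /= /andP[lX /IH[u0 [us [uE ad]]]]]; first by exists [::], [::].
have [lx|lx] := eqVneq l (pos x).
  exists [::], (u0 :: us); split; last by split=> //; split; rewrite -?lx.
  rewrite subst_cons org_pi_cat uE pword_cons /= [RHS]org_pi_cons lx.
  by rewrite /subst_letter /letter_sigma /= eqxx.
have lB : l \in base_letters by rewrite !inE lx.
exists (l :: u0), us; split; last first.
  case: us ad {uE} => [|u1 us] /=; first by move=> ok; apply/andP.
  by move=> [[xX' ok] ad]; split=> //; split=> //; apply/andP.
rewrite subst_cons org_pi_cat uE -org_pi_cat.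
have := letter_sigma_emb (u := [:: l]); rewrite /= (base_letterP lB).1 => /(_ isT).
by rewrite /subst /= cats0 => ->.
Qed.

Lemma letter_admissible_over u0 us : admissible okm okl u0 us ->
  exists u, [/\ all (mem X) u, hv (subst letter_sigma u) = hv (pword u0 us) &
    size u <= 1 * (weight u0 us).+1].
Proof.
have baseX u : all (mem base_letters) u ->
    all (mem X) u /\ subst letter_sigma u = emb u.
  move/allP => uB; split; first by apply/allP => l /uB /base_letterP[].
  by apply: letter_sigma_emb; apply/allP => l /uB /base_letterP[].
suff H : admissible okm okl u0 us -> exists u, [/\ all (mem X) u,
    hv (subst letter_sigma u) = hv (pword u0 us) & size u <= weight u0 us].
  by move/H => [u [h1 h2 h3]]; exists u; split=> //; lia.
elim: us u0 => [|u1 us IH] u0 /=.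
  move/baseX => [h1 h2]; exists u0; split=> //; last by rewrite /weight addn0.
  by rewrite h2 /pword /bword cats0.
move=> [[tX /baseX[h1 h2]] /IH[u [h3 h4 h5]]]; exists (u0 ++ pos x :: u); split.
- by rewrite all_cat h1 /= h3 andbT.
- rewrite subst_cat h2 org_pi_cat subst_cons org_pi_cat h4 [RHS]org_pi_cat.
  by rewrite [X in _ = _ * X]org_pi_cons /subst_letter /letter_sigma /= eqxx.
- by rewrite weight_cons size_cat /= leq_add2l ltnS.
Qed.

(** The exponent sum of the letter c in a factor without c^-1 is nonnegative, and
    in a factor without c it is nonpositive: either way the linking powers are
    monotone. Otherwise powers of c are units, and each linking power can be
    shortened on its own, since prefixes of words over X are words over X. *)
Lemma letter_chain_bounded v0 vs :
  chain c d okm okl (fun=> True) 0 v0 vs ->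
  chain c d okm okl (fun l => absz l <= weight v0 vs) 0 v0 vs.
Proof.
have xc : expsum (y, s) c = 1%R by exact: expsum_letter.
have xd : expsum (y, s) d = 1%R by rewrite expsum_inv expD.
have baseN l : l \notin base_letters -> forall u, all (mem base_letters) u -> l \notin u.
  by move=> lB u uB; apply: contra lB => /(allP uB).
have [iB|iB] := boolP (letter_inv (y, s) \in base_letters); last first.
  have pos_exp v k l : all (mem base_letters) (shifted c d v k l) ->
      (1 * k <= 1 * l + (size v)%:Z)%R.
    move=> /(baseN _ iB) /expsum_ge0; rewrite expsum_shifted xc xd.
    by have := expsum_size (y, s) v; lia.
  apply: (@chain_bounded_monotone _ c d okm okl 1%R) => //.
    by move=> v k l [_ /pos_exp].
  by move=> v k /pos_exp; lia.
have [lB|lB] := boolP ((y, s) \in base_letters); last first.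
  have neg_exp v k l : all (mem base_letters) (shifted c d v k l) ->
      (-1 * k <= -1 * l + (size v)%:Z)%R.
    move=> /(baseN _ lB) /count_memPn h; have := expsum_shifted c d (y, s) v k l.
    rewrite /expsum h -/(expsum _ _) -/(expsum _ _) -/(expsum _ _) xc xd.
    by have := expsum_size (y, s) v; lia.
  apply: (@chain_bounded_monotone _ c d okm okl (-1)%R) => //.
    by move=> v k l [_ /neg_exp].
  by move=> v k /neg_exp; lia.
have unit v k k' l : all (mem base_letters) (shifted c d v k l) ->
    all (mem base_letters) (shifted c d v k' l).
  move=> ok; have -> : shifted c d v k' l = red (wpow c (k - k')%R ++ shifted c d v k l).
    rewrite -[LHS]reduced_red ?red_reduced //; apply/org_pi_red.
    rewrite !red_val !org_pi_cat red_val !org_pi_cat !org_pi_wpow !mulgA -expgzD.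
    by congr (expgz _ _ * _ * _); lia.
  apply: all_red; rewrite all_cat ok andbT.
  by case: (k - k')%R => n; rewrite /wpow; [elim: n => //= n ->|elim: n.+1 => //= m ->];
    rewrite ?lB ?iB.
apply: chain_bounded_free.
- by move=> v k k' l [tX /unit]; split.
- by move=> v k k' l /unit; apply.
- move=> v k l [tX ok].
  have cd : cyc_reduced d by exact: cyc_reduced_inv.
  have [l' sl' [w E]] := shifted_prefix c v l cd.
  exists l' => //; split=> //; apply: (unit _ 0%R).
  by move: (unit _ _ 0%R _ ok); rewrite E all_cat => /andP[].
Qed.

Theorem letter_stable_decidable : decidable_language (submonoid_words r X).
Proof.
have cc : cyc_reduced c by rewrite /cyc_reduced /= andbT /compat eq_sym letter_inv_neq.
have sE : subst letter_sigma r = hnn_relator c d.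
  rewrite /hnn_relator word_invK -(letter_sigma_emb Dx) !subst_cons /subst_letter.
  by rewrite /letter_sigma /= eqxx (negPf yx); case: s.
have tE : subst letter_tau (hnn_relator c d) = r.
  rewrite /hnn_relator word_invK subst_cons subst_cat !subst_cons letter_tau_emb.
  by rewrite /subst_letter /=; case: s.
apply: (submonoid_decidable cc (cyc_reduced_inv cycD) (sigma := letter_sigma)
  (tau := letter_tau) _ _ _ _ _ letter_over_admissible letter_admissible_over
  letter_chain_bounded).
- by rewrite sE org_pi_relator.
- by rewrite tE org_pi_relator.
- move=> a; rewrite /letter_sigma; case: eqP => [->|_] //.
- by move=> u [tX /all_red]; split.
- by move=> u /all_red.
Qed.

End LetterStable.

Section Orientable.
Variable g : nat.
Local Notation A := ('I_g + 'I_g)%type.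

Definition handle (i : 'I_g) : word A := word_comm [:: pos (inl i)] [:: pos (inr i)].

Lemma submonoid_words_handle (i : 'I_g) (X : {set letter A}) :
  (forall W : word A,
     (forall l, l \in W -> l.1 != inl i /\ l.1 != inr i) ->
     (exists js, W = flatten [seq handle j | j <- js]) ->
     decidable_language (submonoid_words (handle i ++ W) X)) ->
  decidable_language (submonoid_words (orientable_relator g) X).
Proof.
move=> dec; rewrite /orientable_relator.
have := enum_uniq 'I_g; have := mem_enum 'I_g i; case/splitPr => p q upq.
rewrite map_cat flatten_cat; apply: submonoid_words_rot.
rewrite -catA -flatten_cat -map_cat; apply: dec; last by exists (q ++ p).
move=> l /flattenP[_ /mapP[j jqp ->] lj].
have ji : j != i.
  apply/eqP => ji; move: upq; rewrite cat_uniq /= -ji.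
  by move: jqp; rewrite mem_cat => /orP[] ->; rewrite /= ?andbF.
by move: lj; rewrite !inE => /or4P[] /eqP -> /=.
Qed.

Lemma handles_path js k (z : letter A) :
  (if z.1 is inr _ then z.2 else ~~ z.2) ->
  path (@compat _) (inr k, true) (rcons (flatten [seq handle j | j <- js]) z).
Proof.
move=> zP; elim: js k => [|j js IH] k /=.
  by case: z zP => -[a|a] [] //= _; rewrite /compat /letter_inv ?xpair_eqE ?andbF.
by rewrite IH /compat /letter_inv /= ?xpair_eqE ?andbF.
Qed.

Lemma handles_cycle js (z : letter A) : (if z.1 is inr _ then z.2 else ~~ z.2) ->
  cycle (@compat _) (z :: flatten [seq handle j | j <- js]).
Proof.
move=> zP; case: js => [|j js] /=; first by rewrite /compat eq_sym letter_inv_neq.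
rewrite handles_path // andbT /compat /letter_inv /= ?xpair_eqE ?andbF /=.
by case: z zP => -[a|a] [] //= _; rewrite /compat /letter_inv ?xpair_eqE ?andbF.
Qed.

(** The relator is a_i b_i a_i^-1 b_i^-1 W up to rotation, where a_i conjugates
    the letter b_i, and b_i conjugates the letter a_i^-1, so that either of them can
    be the stable letter. *)
Theorem orientable_submonoid_decidable (X : {set letter A}) a :
  ~~ ([set pos a; letter_inv (pos a)]%SET \subset X) ->
  decidable_language (submonoid_words (orientable_relator g) X).
Proof.
rewrite finset.subUset !finset.sub1set negb_and.
wlog aX : X / (a, true) \notin X.
  move=> H /orP[aX|aX]; last by apply: H => //; rewrite aX orbT.
  apply: submonoid_words_inv; apply: H; first by rewrite inE.
  by rewrite !inE letter_invK aX orbT.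
move=> _; case: a aX => i aX; apply: (@submonoid_words_handle i) => W Wi [js WE].
  apply: (@letter_stable_decidable _ (inl i) (inr i) false ((inr i, true) :: W)) => //.
  - by apply/allP => l; rewrite inE => /orP[/eqP -> //|/Wi[]].
  - by rewrite /cyc_reduced WE handles_cycle.
  - rewrite -cat1s expsum_cat (expsum_letter_inv (inr i, false)) expsum_eq0 //.
      by apply/negP => /Wi[_] /=; rewrite eqxx.
    by apply/negP => /Wi[_] /=; rewrite eqxx.
rewrite -[handle i ++ W]cat1s; apply: submonoid_words_rot.
apply: (@letter_stable_decidable _ (inr i) (inl i) true (W ++ [:: pos (inl i)])) => //.
- by apply/allP => l; rewrite mem_cat inE => /orP[/Wi[]|/eqP ->].
- rewrite /cyc_reduced cats1 -rot1_cons rot_cycle WE handles_cycle // andbT.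
  by rewrite -size_eq0 size_rot.
- rewrite expsum_cat expsum_eq0 ?(expsum_letter_inv (inl i, true)) //.
    by apply/negP => /Wi[] /=; rewrite eqxx.
  by apply/negP => /Wi[] /=; rewrite eqxx.
Qed.

End Orientable.

(** * Non-orientable surface groups *)

(** The group of x^2 D is the amalgam of the infinite cyclic group of x and the
    free group on the other letters along x^2 = D^-1. It embeds in the HNN extension
    of the free group on all letters with t x^2 t^-1 = D^-1, by conjugating x by t;
    sending t to 1 is a retraction. Words without x remain in the base group. *)
Section SquareRoot.
Variables (A : finType) (x : A) (D : word A) (X : {set letter A}).
Hypotheses (Dx : all (fun l => l.1 != x) D) (cycD : cyc_reduced D).
Hypothesis Xx : forall l, l \in X -> l.1 != x.

Local Notation c := [:: pos x; pos x].
Local Notation d := (word_inv D).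
Local Notation r := (pos x :: pos x :: D).
Local Notation hv := (org_pi (hnn_relator c d)).

Definition root_sigma (a : A) : word (option A) :=
  if a == x then [:: pos None; pos (Some x); (None, true)] else [:: pos (Some a)].

Definition root_tau (o : option A) : word A := if o is Some a then [:: pos a] else [::].

Lemma root_sigma_emb u : all (fun l => l.1 != x) u -> subst root_sigma u = emb u.
Proof.
elim: u => // -[a b] u IH /= /andP[ax ux].
by rewrite subst_cons IH // /subst_letter /root_sigma /= (negPf ax); case: b.
Qed.

Lemma root_tau_emb u : subst root_tau (emb u) = u.
Proof. by elim: u => // -[a []] u IH; rewrite /= subst_cons IH. Qed.

Theorem root_decidable : decidable_language (submonoid_words r X).
Proof.
have cc : cyc_reduced c.
  by rewrite /cyc_reduced /= /compat eq_sym letter_inv_neq.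
have embX u : all (mem X) u -> subst root_sigma u = emb u.
  by move=> uX; apply: root_sigma_emb; apply: sub_all uX => l /Xx.
apply: (@submonoid_decidable _ _ _ _ _ cc (cyc_reduced_inv cycD) root_sigma root_tau
  _ _ _ (fun=> False) (fun u => all (mem X) u) _ _ 1).
- have := hnn_rel c d; rewrite emb_inv org_pi_inv => E.
  rewrite (_ : subst _ _ = [:: pos None] ++ [:: pos (Some x)] ++ [:: (None, true)] ++
    [:: pos None] ++ [:: pos (Some x)] ++ [:: (None, true)] ++ emb D); last first.
    by rewrite -(root_sigma_emb Dx) !subst_cons /subst_letter /root_sigma /= eqxx.
  rewrite !org_pi_cat org_pi_true !mulgA mulgVK -[hv [:: pos None] * _ * _]mulgA.
  by rewrite -[hv [:: pos (Some x)] * _]org_pi_cat E mulgK mulVg.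
- by rewrite /hnn_relator word_invK subst_cons subst_cat !subst_cons root_tau_emb org_pi_relator.
- move=> a; rewrite /root_sigma; case: eqP => [->|_] //.
- by [].
- by move=> u /all_red.
- move=> u uX; exists u, [::]; split=> //.
  by rewrite embX // /pword /bword cats0.
- move=> u0 [|u us] //= [] // u0X; exists u0; split=> //.
    by rewrite embX // /pword /bword cats0.
  by rewrite /weight; lia.
- by move=> v0 [|v vs] //= [l []].
Qed.

End SquareRoot.

(** In i^2 U j^2 V the letters i and j^-1 are generators, but not their inverses,
    and U is a unit. With s = U j^-1 U^-1 i^-1 and t = i, the relator becomes
    t s^-1 t^-1 s^-1 U V, so the group is an HNN extension in which U j^-1 U^-1 = s t
    is positive. *)
Section PositivePair.
Variables (A : finType) (i j : A) (U V : word A) (X : {set letter A}).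

Definition avoids (u : word A) : bool := all (fun l => (l.1 != i) && (l.1 != j)) u.

Hypotheses (ij : i != j) (Uij : avoids U) (Vij : avoids V).
Hypothesis UX : forall l, l \in U -> (l \in X) && (letter_inv l \in X).
Hypotheses (iX : (i, false) \in X) (iX' : (i, true) \notin X).
Hypotheses (jX : (j, true) \in X) (jX' : (j, false) \notin X).

Local Notation D := ((j, true) :: U ++ V).
Hypothesis cycD : cyc_reduced D.

Local Notation c := [:: (j, true)].
Local Notation d := (word_inv D).
Local Notation r := ([:: pos i; pos i] ++ U ++ [:: pos j; pos j] ++ V).
Local Notation hv := (org_pi (hnn_relator c d)).

(** The letter Some j of the base group stands for s, and None for t = i. *)
Definition pair_sigma (a : A) : word (option A) :=
  if a == i then [:: pos None]
  else if a == j then emb (word_inv U) ++ [:: (None, true); (Some j, true)] ++ emb U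
  else [:: pos (Some a)].

Definition pair_tau (o : option A) : word A :=
  if o is Some a then
    if a == j then U ++ [:: (j, true)] ++ word_inv U ++ [:: (i, true)] else [:: pos a]
  else [:: pos i].

Lemma pair_sigma_emb u : avoids u -> subst pair_sigma u = emb u.
Proof.
elim: u => // -[a b] u IH /= /andP[/andP[ai aj] ux].
by rewrite subst_cons IH // /subst_letter /pair_sigma /= (negPf ai) (negPf aj); case: b.
Qed.

Lemma pair_tau_emb u : avoids u -> subst pair_tau (emb u) = u.
Proof.
elim: u => // -[a b] u IH /= /andP[/andP[ai aj] ux].
by rewrite subst_cons IH // /subst_letter /= (negPf aj); case: b.
Qed.

Lemma pair_sigma_j q : org_pi q (pair_sigma j) =
  (org_pi q (emb U))^-1 * (org_pi q [:: pos None])^-1 * (org_pi q [:: pos (Some j)])^-1 *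
  org_pi q (emb U).
Proof.
rewrite /pair_sigma eq_sym (negPf ij) eqxx org_pi_cat emb_inv org_pi_inv.
by rewrite org_pi_cat org_pi_cons !org_pi_true !mulgA.
Qed.

Lemma pair_tau_j q : org_pi q (pair_tau (Some j)) =
  org_pi q U * (org_pi q [:: pos j])^-1 * (org_pi q U)^-1 * (org_pi q [:: pos i])^-1.
Proof. by rewrite /pair_tau eqxx !org_pi_cat org_pi_inv !org_pi_true !mulgA. Qed.

Lemma pair_sigma_r : hv (subst pair_sigma r) = 1.
Proof.
have sigma_i : pair_sigma i = [:: pos None] by rewrite /pair_sigma eqxx.
have ED : hv (emb D) = (hv [:: pos (Some j)])^-1 * (hv (emb U) * hv (emb V)).
  by rewrite -org_pi_true -!org_pi_cat -emb_cat.
have := hnn_rel c d; rewrite emb_inv org_pi_inv ED -[emb c]/[:: (Some j, true)] org_pi_true => E.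
rewrite (_ : r = [:: pos i] ++ [:: pos i] ++ U ++ [:: pos j] ++ [:: pos j] ++ V) //.
rewrite !subst_cat !subst_pos.
rewrite !(pair_sigma_emb Uij) !(pair_sigma_emb Vij) sigma_i !org_pi_cat pair_sigma_j.
by rewrite !mulgA !mulgK E mulgK -!mulgA mulVg.
Qed.

Lemma pair_tau_rel : org_pi r (subst pair_tau (hnn_relator c d)) = 1.
Proof.
have -> : subst pair_tau (hnn_relator c d) =
    [:: pos i] ++ word_inv (pair_tau (Some j)) ++ [:: (i, true)] ++
    word_inv (pair_tau (Some j)) ++ U ++ V.
  rewrite /hnn_relator word_invK (_ : _ :: _ = [:: pos None] ++ [:: (Some j, true)] ++
    [:: (None, true)] ++ [:: (Some j, true)] ++ emb (U ++ V)) //.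
  by rewrite emb_cat !subst_cat !subst_neg !subst_pos !pair_tau_emb.
have R : org_pi r ([:: pos i] ++ [:: pos i] ++ U ++ [:: pos j] ++ [:: pos j] ++ V) = 1.
  exact: org_pi_relator.
rewrite !org_pi_cat in R; rewrite !org_pi_cat !org_pi_inv org_pi_true pair_tau_j.
rewrite -[RHS]R !invgM !invgK; move: (org_pi r [:: pos i]) (org_pi r U) => a u.
by rewrite !mulgA !mulgVK.
Qed.

Lemma pair_tauK a : org_pi r (subst pair_tau (pair_sigma a)) = org_pi r [:: pos a].
Proof.
rewrite /pair_sigma; case: eqP => [->|_]; first by rewrite subst_pos.
case: (eqVneq a j) => [->|aj]; last by rewrite subst_pos /= (negPf aj).
rewrite (_ : [:: (None, true); _] = [:: (None, true)] ++ [:: (Some j, true)]) //.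
rewrite emb_inv !subst_cat subst_inv !subst_neg !pair_tau_emb // !org_pi_cat !org_pi_inv.
rewrite pair_tau_j /= !invgM !invgK.
by rewrite !mulgA !mulgVK mulVg mul1g.
Qed.

Definition pair_base : {set letter A} := [set l in X | (l.1 != i) && (l.1 != j)].

Local Notation based := (all (mem pair_base)).

Let okl u : Prop := based u.
Let okm u : Prop := exists2 u', based u' & u = u' \/ u = rcons u' (pos j).

Lemma based_avoids u : based u -> avoids u.
Proof. by apply: sub_all => l /=; rewrite inE => /andP[]. Qed.

Lemma based_X u : based u -> all (mem X) u.
Proof. by apply: sub_all => l /=; rewrite inE => /andP[]. Qed.

Lemma based_U : based U /\ based (word_inv U).
Proof.
split; first by apply/allP => l lU; rewrite !inE (allP Uij) // (andP (UX lU)).1.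
rewrite all_rev all_map; apply/allP => l lU.
by rewrite !inE (allP Uij l lU) (andP (UX lU)).2.
Qed.

Lemma pair_okm_red u : okm u -> okm (red u).
Proof.
move=> [u' bu' uE]; exists (red u'); first exact: all_red.
case: uE => ->; [by left|right]; apply: red_rcons.
  by apply/negP => /(allP (based_avoids bu')); rewrite eqxx andbF.
by apply/negP => /(allP (based_avoids bu')); rewrite eqxx andbF.
Qed.

(** A factor contains s at most once, as its last letter, because the generators
    involving s and t are t itself and the conjugate U^-1 s t U. *)
Lemma pair_over_admissible u : all (mem X) u ->
  exists u0 us, hv (subst pair_sigma u) = hv (pword u0 us) /\ admissible okm okl u0 us.
Proof.
elim: u => [_|l u IH /= /andP[lX /IH[u0 [us [uE ad]]]]]; first by exists [::], [::].
have prepend w : based w -> admissible okm okl (w ++ u0) us.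
  move=> bw; case: us ad {uE} => [|u1 us] /=; first by rewrite /okl all_cat bw.
  move=> [[u' bu' u'E] ad]; split=> //; exists (w ++ u'); first by rewrite all_cat bw.
  by case: u'E => ->; [left|right]; rewrite ?rcons_cat.
have pwordE w : hv (pword (w ++ u0) us) = hv (emb w) * hv (pword u0 us).
  by rewrite /pword /bword /= emb_cat -catA org_pi_cat.
case: l lX => a b lX; have [ai|ai] := eqVneq a i.
  rewrite {a}ai in lX *; case: b lX => [|_]; first by rewrite (negPf iX').
  exists [::], (u0 :: us); split; last by split=> //; exists [::] => //; left.
  by rewrite subst_cons org_pi_cat uE /subst_letter /= /pair_sigma eqxx pword_val mul1g.
have [aj|aj] := eqVneq a j.
  rewrite {a ai}aj in lX *; case: b lX => [_|]; last by rewrite (negPf jX').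
  exists (rcons (word_inv U) (pos j)), ((U ++ u0) :: us); split; last first.
    split; last exact: prepend based_U.1.
    by exists (word_inv U); [exact: based_U.2|right].
  rewrite subst_cons org_pi_cat uE pword_val pwordE /subst_letter /= org_pi_inv pair_sigma_j.
  rewrite -cats1 emb_cat [hv (emb _ ++ _)]org_pi_cat emb_inv org_pi_inv.
  by rewrite !invgM !invgK !mulgA.
exists ([:: (a, b)] ++ u0), us; split; last first.
  by apply: prepend; rewrite /= !inE lX /= ai aj.
rewrite pwordE subst_cons org_pi_cat uE; congr (_ * _).
by have := pair_sigma_emb (u := [:: (a, b)]); rewrite /subst /= cats0 ai aj => ->.
Qed.

Local Notation K := (2 * size U + 1).

Lemma pair_admissible_over u0 us : admissible okm okl u0 us ->
  exists u, [/\ all (mem X) u, hv (subst pair_sigma u) = hv (pword u0 us) &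
    size u <= K * (weight u0 us).+1].
Proof.
elim: us u0 => [|u1 us IH] u0 /=.
  move=> bu; exists u0; split; first exact: based_X.
    by rewrite pair_sigma_emb ?based_avoids // /pword /bword cats0.
  by rewrite /weight /= addn0; nia.
move=> [[u' bu' u'E] /IH[u [uX uE su]]]; rewrite weight_cons.
have [bU bUV] := based_U.
have step a b : a <= K * b.+1 -> a + size u <= K * (b + (weight u1 us).+1).+1.
  by move=> ab; rewrite -addSn mulnDr leq_add.
case: u'E => ->.
  exists (u' ++ pos i :: u); split.
  - by rewrite all_cat based_X //= iX uX.
  - rewrite subst_cat org_pi_cat pair_sigma_emb ?based_avoids // subst_cons org_pi_cat uE.
    by rewrite pword_val /subst_letter /= /pair_sigma eqxx.
  - rewrite size_cat /= addnS -addSn; apply: step.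
    by rewrite leq_pmull // addn1.
exists (u' ++ U ++ (j, true) :: word_inv U ++ u); split.
- by rewrite !all_cat (based_X bu') (based_X bU) /= jX all_cat (based_X bUV) uX.
- rewrite (_ : _ ++ _ = u' ++ U ++ [:: (j, true)] ++ word_inv U ++ u) // !subst_cat subst_neg.
  rewrite (pair_sigma_emb (based_avoids bu')) (pair_sigma_emb Uij).
  rewrite (pair_sigma_emb (based_avoids bUV)).
  rewrite pword_val -cats1 emb_cat; move: (pword u1 us) uE => P uE.
  rewrite !org_pi_cat uE org_pi_inv pair_sigma_j emb_inv org_pi_inv !invgM !invgK.
  by rewrite !mulgA mulgK mulgK.
- rewrite !size_cat /= size_cat size_rev size_map size_rcons.
  have -> : forall n m k : nat, n + (m + (m + k).+1) = n + (2 * m + 1) + k by lia.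
  by apply: step; rewrite mulnS addnC leq_add2l (leq_trans (leqnSn _)) // leq_pmull // addn1.
Qed.

(** The exponent sum of s is 0 or 1 on admissible factors, and -1 and 1 on the
    words s^-1 and d that are linked. *)
Lemma pair_chain_bounded v0 vs :
  chain c d okm okl (fun=> True) 0 v0 vs ->
  chain c d okm okl (fun l => absz l <= weight v0 vs) 0 v0 vs.
Proof.
have exp0 u : avoids u -> expsum (pos j) u = 0%R.
  by move=> /allP ua; apply: expsum_eq0; apply/negP => /ua; rewrite eqxx andbF.
apply: (@chain_bounded_small _ c d okm okl (pos j)).
- by rewrite (expsum_letter_inv (pos j)).
- rewrite expsum_inv -cat1s !expsum_cat (expsum_letter_inv (pos j)) !exp0 //.
- move=> u [u' /based_avoids/exp0 u'0] [] ->; first by rewrite u'0.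
  by rewrite -cats1 expsum_cat u'0 expsum_letter.
- by move=> u /based_avoids/exp0.
Qed.

Theorem positive_pair_decidable : decidable_language (submonoid_words r X).
Proof.
have cc : cyc_reduced c by rewrite /cyc_reduced /= andbT /compat eq_sym letter_inv_neq.
apply: (submonoid_decidable cc (cyc_reduced_inv cycD) pair_sigma_r pair_tau_rel pair_tauK
  pair_okm_red _ pair_over_admissible pair_admissible_over pair_chain_bounded).
by move=> u; exact: all_red.
Qed.

End PositivePair.

(** The group has two elements and the submonoid is trivial, so that membership
    is the parity of the length. *)
Lemma involution_decidable (A : finType) (i : A) (X : {set letter A}) :
  (forall j, j = i) -> (forall l, l \notin X) ->
  decidable_language (submonoid_words [:: pos i; pos i] X).
Proof.
move=> Ai X0; set r := [:: _; _].
have cpar : computable (@enc_word A) enc_bool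
    (fun w => foldr (fun (_ : letter A) b => if b then false else true) true w).
  apply: (computable_foldr (f := fun _ _ b => if b then false else true)) (computable_id _).
    apply: computable_if; try exact: computable_const.
    exact: (computable_snd (computable_snd (computable_id _))).
  exact: computable_const.
apply: (decidable_computable cpar) => w.
have -> : foldr (fun (_ : letter A) b => if b then false else true) true w = ~~ odd (size w).
  by elim: w => //= l w ->; case: odd.
have XE : submonoid_words r X w <-> word_equiv r [::] w.
  split=> [[[|l x] //]|rw]; last by exists [::].
  by rewrite /= (negPf (X0 l)).
apply: (iff_trans XE); split=> [|ew].
  have par u v : word_equiv r u v -> odd (size u) = odd (size v).
    elim=> {u v} [//|u v _ ->//|u v t _ -> //|u v l|u v];
    by rewrite !size_cat !oddD.
  by move/par => <-.
have ii : org_pi r [:: pos i] * org_pi r [:: pos i] = 1.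
  by rewrite -org_pi_cat; exact: org_pi_relator.
have letterE l : org_pi r [:: l] = org_pi r [:: pos i].
  case: l => a b; rewrite (Ai a); case: b => //.
  by rewrite org_pi_true; exact: mulg1_eq.
have wE : org_pi r w = org_pi r [:: pos i] ^+ size w.
  by elim: (w) => // l u IH; rewrite org_pi_cons letterE IH /= expgS.
apply/org_pi_eq; rewrite wE -(odd_double_half (size w)) (negPf ew) add0n -mul2n expgnA.
by rewrite expgS expg1 ii expg1n.
Qed.

Section Adjacent.
Variables (T : Type) (P Q : pred T).

(** Between the last element satisfying P and the first one after it satisfying
    Q there are only neutral elements; w collects those met so far. *)
Lemma adjacent_pair_neutral x w s : P x -> all (fun k => ~~ P k && ~~ Q k) w -> has Q s ->
  exists s1 i u j s2, [/\ x :: w ++ s = s1 ++ i :: u ++ j :: s2, P i, Q j &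
    all (fun k => ~~ P k && ~~ Q k) u].
Proof.
elim: s x w => // k s IH x w Px wn /=; have [Qk _|Qk /= hs] := boolP (Q k).
  by exists [::], x, w, k, s.
have [Pk|Pk] := boolP (P k).
  have [s1 [i [u [j [s2 [E Pi Qj un]]]]]] := IH k [::] Pk isT hs.
  by exists (x :: w ++ s1), i, u, j, s2; split; rewrite //= -catA -E.
have [|s1 [i [u [j [s2 [E Pi Qj un]]]]]] := IH x (rcons w k) Px _ hs.
  by rewrite all_rcons Pk Qk.
by exists s1, i, u, j, s2; split=> //; rewrite -E cat_rcons.
Qed.

End Adjacent.

Section NonOrientable.
Variable g : nat.
Local Notation A := 'I_g.

Definition squares (s : seq A) : word A := flatten [seq [:: pos k; pos k] | k <- s].

Lemma squares_cat s t : squares (s ++ t) = squares s ++ squares t.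
Proof. by rewrite /squares map_cat flatten_cat. Qed.

Lemma squares_rot s t X :
  decidable_language (submonoid_words (squares (t ++ s)) X) ->
  decidable_language (submonoid_words (squares (s ++ t)) X).
Proof. by rewrite !squares_cat; exact: submonoid_words_rot. Qed.

Lemma mem_squares s l : l \in squares s -> l.1 \in s /\ l.2 = false.
Proof.
by move/flattenP => [_ /mapP[k ks ->]]; rewrite !inE orbb => /eqP ->.
Qed.

Lemma positive_cyc_reduced (l : letter A) (u : word A) :
  {in u, forall l', l'.2 = false} -> (l.2 -> l.1 \notin unzip1 u) -> cyc_reduced (l :: u).
Proof.
move=> posu lu; rewrite /cyc_reduced -[_ && _]/(cycle _ _).
have luN l' : l' \in u -> l' != letter_inv l.
  move=> l'u; apply/eqP => l'E; have := posu _ l'u; rewrite l'E => /negbFE lt.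
  by have := lu lt; rewrite -[l.1]/((letter_inv l).1) -l'E map_f.
apply: (sub_in_cycle (P := mem (l :: u)) (e := fun _ _ => true)).
- move=> a b; rewrite /compat !inE => /orP[/eqP ->|au] /orP[/eqP ->|bu] _.
  + by rewrite eq_sym letter_inv_neq.
  + exact: luN.
  + by rewrite eq_sym (inv_eq (@letter_invK A)) luN.
  + apply/eqP => /(congr1 snd); rewrite (posu _ bu) /= (posu _ au).
    by [].
- exact/allP.
- by apply/(pathP l).
Qed.

(** Each generator a_k has both, one or none of a_k and a_k^-1 in X. If none has
    both missing, and both signs are missing somewhere, then in cyclic order some
    generator with only a_k in X is followed, after generators with both, by
    one with only a_k^-1 in X. *)
Theorem nonorientable_submonoid_decidable (X : {set letter A}) :
  decidable_language (submonoid_words (nonorientable_relator g) X).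
Proof.
rewrite -[nonorientable_relator g]/(squares (enum A)).
have enum_split k : exists p q, [/\ enum A = p ++ k :: q, uniq (k :: q ++ p) &
    forall j, (j == k) || (j \in q ++ p)].
  have := enum_uniq A; have := mem_enum A; have := mem_enum A k.
  case/splitPr => p q memA; rewrite uniq_catC => kqp.
  exists p, q; split=> // j; have : j \in p ++ k :: q by rewrite memA.
  by rewrite !mem_cat inE; case: eqP => //= _; rewrite orbC.
(* If every generator, or the inverse of every generator, is in X, then the
   relator makes the submonoid the whole group. *)
have whole (Y : {set letter A}) : (forall k, pos k \in Y) ->
    decidable_language (submonoid_words (squares (enum A)) Y).
  move=> posY; apply: submonoid_words_all => -[k b].
  have posY' s : all (mem Y) (squares s).
    by apply/allP => -[m b'] /mem_squares[_ /= ->]; exact: posY.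
  case: b; last by exists [:: pos k]; [rewrite /= posY|exact: word_equiv_refl].
  have [p [q [E _ _]]] := enum_split k; rewrite E squares_cat.
  exists (pos k :: squares (q ++ p)); first by rewrite /= posY posY'.
  apply/org_pi_eq; rewrite org_pi_true; apply/esym/mulg1_eq.
  rewrite -org_pi_cat (_ : [:: pos k] ++ _ = squares (k :: q) ++ squares p); last first.
    by rewrite squares_cat.
  have := org_pi_relator (squares p ++ squares (k :: q)).
  by rewrite org_pi_cat => /mulg1_eq R; rewrite org_pi_cat -R mulVg.
have [[k /norP[kX kX']]|none] := pselect (exists k, ~~ ((pos k \in X) || ((k, true) \in X))).
  (* Neither a_k nor its inverse is in X, so the submonoid lies in the subgroup
     generated by the other letters, which is free; without other letters the
     relator leaves a group with two elements. *)
  have [p [q [-> /andP[kqp _] memA]]] := enum_split k.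
  apply: squares_rot.
  have kX1 l : l \in X -> l.1 != k.
    by apply: contraTneq => lk; case: l lk => m [] /= ->.
  have [qp0|qp0] := eqVneq (q ++ p) [::].
    rewrite /= qp0; apply: involution_decidable => [j|l].
      by have := memA j; rewrite qp0 orbF => /eqP.
    apply/negP => /kX1; have := memA l.1; rewrite qp0 orbF => /eqP ->.
    by rewrite eqxx.
  apply: (@root_decidable _ k (squares (q ++ p))) => //.
    by apply/allP => l /mem_squares[lqp _]; apply: contraNneq kqp => <-.
  case: (q ++ p) qp0 => // m s _.
  apply: (@positive_cyc_reduced (pos m) (pos m :: squares s)) => // l.
  by rewrite inE => /predU1P[->//|/mem_squares[]].
have {}none k : (pos k \in X) || ((k, true) \in X).
  by apply/negP => /negP kN; apply: none; exists k.
have [/forallP|/forallPn[j0 Qj0]] := boolP [forall k, pos k \in X]; first exact: whole.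
have [/forallP negX|/forallPn[i0 Pi0]] := boolP [forall k, (k, true) \in X].
  by apply: submonoid_words_inv; apply: whole => k; rewrite inE; exact: negX.
have PQ k : ~~ (((k, true) \notin X) && (pos k \notin X)).
  by rewrite negb_and !negbK orbC none.
have [p [q [-> uqp memA]]] := enum_split i0.
apply: squares_rot; rewrite cat_cons.
have hasQ : has (fun k => pos k \notin X) (q ++ p).
  apply/hasP; exists j0 => //; have := memA j0.
  by case: eqVneq => [j0i0|//]; have := PQ j0; rewrite Qj0 j0i0 Pi0.
have [s1 [i [u [j [s2 [E Pi Qj un]]]]]] :=
  adjacent_pair_neutral (P := fun k => (k, true) \notin X) (w := [::]) Pi0 isT hasQ.
rewrite /= in E; rewrite E uniq_catC /= -catA /= in uqp; rewrite E.
apply: squares_rot; rewrite cat_cons -catA cat_cons.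
have {uqp} [iuqp] := andP uqp; rewrite uniq_catC /= => /andP[jsu _].
have notij k : k \in u -> k != i /\ k != j.
  move=> ku; split; apply/eqP => kE.
    by move: iuqp; rewrite mem_cat -kE ku.
  by move: jsu; rewrite mem_cat -kE ku orbT.
have notij' k : k \in s2 ++ s1 -> k != i /\ k != j.
  move=> ks; split; apply/eqP => kE.
    by move: iuqp; rewrite mem_cat inE -kE ks !orbT.
  by move: jsu; rewrite mem_cat -kE ks.
have avoids_squares w : (forall k, k \in w -> k != i /\ k != j) -> avoids i j (squares w).
  by move=> wP; apply/allP => l /mem_squares[/wP[li lj] _]; rewrite li lj.
have -> : squares (i :: u ++ j :: s2 ++ s1) =
    [:: pos i; pos i] ++ squares u ++ [:: pos j; pos j] ++ squares (s2 ++ s1).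
  by rewrite -[i :: _]/([:: i] ++ u ++ [:: j] ++ (s2 ++ s1)) !squares_cat.
have iX := none i; rewrite (negPf Pi) orbF in iX.
have jX := none j; rewrite (negPf Qj) /= in jX.
apply: positive_pair_decidable => //.
- by move: iuqp; rewrite mem_cat inE; case: eqVneq => [->|]; rewrite ?orbT.
- exact: avoids_squares.
- exact: avoids_squares.
- move=> [k b] /mem_squares[/(allP un) /andP[kP kQ] /= ->].
  by rewrite !negbK in kP kQ; rewrite kQ.
- rewrite -squares_cat; apply: positive_cyc_reduced => [l /mem_squares[]//|_].
  apply/negP => /mapP[l /mem_squares[lus _] jl].
  by move: jsu; rewrite (_ : j = l.1) // mem_cat orbC -mem_cat lus.
Qed.

End NonOrientable.

Local Close Scope group_scope.

Theorem theorem4p4 (g : nat) (hg : 1 <= g) :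
  (forall M : set (orientable_surface_group g),
     magnus_submonoid (orientable_relator g) M ->
     membership_decidable (org_gen (orientable_relator g)) M) /\
  (forall M : set (nonorientable_surface_group g),
     magnus_submonoid (nonorientable_relator g) M ->
     membership_decidable (org_gen (nonorientable_relator g)) M).
Proof.
split; apply: magnus_decidable => X [a aX].
  exact: orientable_submonoid_decidable aX.
exact: nonorientable_submonoid_decidable.
Qed.
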